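(* Let $p\in\mathbb{N}$, let $f\in A_p$, and let $g\in R_f(G)$. Then $g$ has finite even order $2s$ for some $s\in\mathbb{N}$ such that $p/s$ is an odd integer.
   Context: $G$ denotes the group (under composition) of biholomorphic germs at $0$ in one complex variable: germs of functions $f$ holomorphic near $0$ with $f(0)=0$ and $f'(0)\neq 0$. The multiplier of $f$ is $m(f)=f'(0)$. $G_1=\{f\in G: f'(0)=1\}$, and for $p\in\mathbb{N}$, $G_p=\{f\in G_1: f^{(k)}(0)=0 \text{ for } 2\le k\le p\}$ and $A_p=G_p\setminus G_{p+1}$ (so $f\in A_p$ means $f(z)=z+f_{p+1}z^{p+1}+O(z^{p+2})$ with $f_{p+1}\ne 0$). For $f\in G$, $R_f(G)$ is the set of $g\in G$ with $g^{-1}\circ f\circ g=f^{-1}$. *)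

(* Defs.v *)
From HB Require Import structures.
From mathcomp Require Import all_boot all_order all_algebra.
From mathcomp Require Import all_classical all_reals all_analysis.
From mathcomp Require Import complex.
Set Implicit Arguments. Unset Strict Implicit. Unset Printing Implicit Defensive.
Import Order.TTheory GRing.Theory Num.Theory.
Import numFieldNormedType.Exports.
Local Open Scope ring_scope.
Local Open Scope classical_set_scope.
Local Open Scope complex_scope.

Definition CC (R : realType) : numFieldType := R[i].

Definition germ_eq (R : realType) (f g : CC R -> CC R) : Prop :=
  \forall z \near (0 : CC R), f z = g z.

Definition holo_near0 (R : realType) (f : CC R -> CC R) : Prop :=
  \forall z \near (0 : CC R), derivable f z 1.

(* f represents an element of G: biholomorphic germ fixing 0. *)
Definition inG (R : realType) (f : CC R -> CC R) : Prop :=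
  [/\ holo_near0 f, f 0 = 0 & f^`() 0 != 0].

Definition inGp (R : realType) (p : nat) (f : CC R -> CC R) : Prop :=
  [/\ inG f, f^`() 0 = 1 &
      forall k : nat, (2 <= k <= p)%N -> f^`(k) 0 = 0].

Definition inAp (R : realType) (p : nat) (f : CC R -> CC R) : Prop :=
  inGp p f /\ ~ inGp p.+1 f.

Definition germ_inv (R : realType) (f h : CC R -> CC R) : Prop :=
  [/\ inG h, germ_eq (f \o h) (fun z => z) & germ_eq (h \o f) (fun z => z)].

Definition inRf (R : realType) (f g : CC R -> CC R) : Prop :=
  inG g /\ exists gi fi : CC R -> CC R,
    [/\ germ_inv g gi, germ_inv f fi & germ_eq (gi \o f \o g) fi].

Definition germ_order (R : realType) (g : CC R -> CC R) (n : nat) : Prop :=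
  [/\ (0 < n)%N, germ_eq (iter n g) (fun z => z) &
      forall k : nat, (0 < k < n)%N -> ~ germ_eq (iter k g) (fun z => z)].

(* Main.v *)
(** Write f(z) = z + a z^(p+1) + ... with a <> 0 and let c = g'(0).
    The relation g^-1 f g = f^-1 says f g f = g; comparing the coefficients of
    z^(p+1) gives c^p = -1. Hence c is a root of unity of even order 2s with
    s | p and p/s odd, and no smaller iterate of g is the identity. The iterate
    h = g^(2s) is tangent to the identity and commutes with g and, the exponent
    being even, with f. If h were not the identity, h(z) = z + b z^(q+1) + ...
    with b <> 0; then f h = h f forces q = p, and g h = h g forces c^q = 1,
    a contradiction.

    This needs that a germ which is only assumed complex differentiable near 0
    has a derivative of the same kind and is z^n u(z) with u(0) <> 0 unless it
    vanishes. Both follow from Cauchy's formula on a square, obtained from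
    Goursat's bisection argument applied to the difference quotient
    (f(w) - f(z)) / (w - z), which is differentiable except at w = z. *)

Require Import Defs.
From mathcomp Require Import all_boot all_order all_algebra.
From mathcomp Require Import all_classical all_reals all_analysis.
From mathcomp Require Import complex ring lra.
Set Implicit Arguments. Unset Strict Implicit. Unset Printing Implicit Defensive.
Import Order.TTheory GRing.Theory Num.Theory.
Import numFieldNormedType.Exports.
Import ComplexField.Normc.
Local Open Scope ring_scope.
Local Open Scope classical_set_scope.
Local Open Scope complex_scope.

(** * Integration of complex functions along segments *)

Section RealPrimitives.
Variable R : realType.
Implicit Types (P p : R -> R).

(** Cauchy's formula is used without the value 2 pi i: the integral of 1/(w - z) around the square
    is only shown to be independent of z near 0 and nonzero, and then divided out. Power series and
    their convergence are avoided in the same spirit. Iterating 1/(w - z) = 1/w + z/(w(w - z)) under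
    the integral gives finite Taylor expansions whose remainders are again such integrals. This is
    enough to factor out the exact order of vanishing, and it also shows that a germ with all
    coefficients zero vanishes, because the remainder after n steps is at most 32 M / 2^n.
    Coefficients are then compared through limits at 0. For w(z) = z + b z^(q+1) + o(z^(q+1)), an
    increment phi(w(z)) - phi(z) is evaluated in two ways, once from the form of phi and once from
    the functional equation, and uniqueness of the limit gives the equation between coefficients.
    The difference quotient in Cauchy's formula is known only to be continuous at w = z, where the
    usual o(t^2) estimate of Goursat's argument fails; this is why the bisection compares integrals
    with a weight larger than the area. *)

Lemma derive_mean_value P p (a b : R) : a <= b ->
  (forall t, a <= t <= b -> is_derive t 1 P (p t)) ->
  exists2 c, a <= c <= b & P b - P a = p c * (b - a).
Proof.
move=> ab dP.
have [||c] := @MVT_segment R P p a b ab.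
- move=> t; rewrite in_itv /= => /andP[/ltW h1 /ltW h2].
  by apply: dP; rewrite h1.
- by apply: derivable_within_continuous => t; rewrite in_itv /= => /dP[].
by rewrite in_itv /=; exists c.
Qed.

Lemma primitive_exists p (a b : R) : continuous p ->
  exists P, forall t, a <= t <= b -> is_derive t 1 P (p t).
Proof.
move=> cp.
(* Starting the integral at [a - 1] makes every point of [a, b], the left end included, interior, so
   that the derivative is two-sided. *)
exists (fun x => \int[@lebesgue_measure R]_(t in `[a - 1, x]) p t)%R.
move=> t /andP[at_ tb].
have [||||dF eF] := @continuous_FTC1_closed R p (a - 1) t (b + 1).
- lra.
- apply: continuous_compact_integrable; first exact: segment_compact.
  exact: continuous_subspaceT.
- by lra.
- exact: cp.
by apply: (DeriveDef dF); rewrite -derive1E.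
Qed.

End RealPrimitives.

Section ComplexIntegral.
Variable R : realType.
Local Notation C := (CC R).
Implicit Types (P g h : R -> C) (a b t : R).

Lemma CnormE (z : C) : `|z| = (normc z)%:C.
Proof. by case: z. Qed.

Lemma normc_ge0 (z : C) : 0 <= normc z.
Proof. by case: z => x y; exact: sqrtr_ge0. Qed.

Lemma ler_normcD (z w : C) : normc (z + w) <= normc z + normc w.
Proof. exact: (@le_normcD R z w). Qed.

Lemma normcVC (z : C) : normc z^-1 = (normc z)^-1.
Proof. exact: normcV. Qed.

Lemma normcMC (z w : C) : normc (z * w) = normc z * normc w.
Proof. exact: normcM. Qed.

Lemma normcXC (z : C) n : normc (z ^+ n) = normc z ^+ n.
Proof.
by elim: n => [|n IH]; rewrite ?expr0 ?normc1 // !exprS normcMC IH.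
Qed.

Lemma normcNC (z : C) : normc (- z) = normc z.
Proof. by case: z => x y /=; rewrite !sqrrN. Qed.

Lemma normc_eq0C (z : C) : (normc z == 0) = (z == 0).
Proof.
by apply/eqP/eqP => [/eq0_normc//|->]; rewrite normc0.
Qed.

Lemma normc_gt0 (z : C) : (0 < normc z) = (z != 0).
Proof. by rewrite lt_def normc_ge0 andbT normc_eq0C. Qed.

(* Componentwise, since [CC R] carries no normed module structure over [R]. *)
Definition Rderiv P t (d : C) :=
  is_derive t 1 (fun x => complex.Re (P x)) (complex.Re d) /\
  is_derive t 1 (fun x => complex.Im (P x)) (complex.Im d).

Lemma Rderiv_eq P t d d' : Rderiv P t d -> d = d' -> Rderiv P t d'.
Proof. by move=> ? <-. Qed.

Lemma RderivD P Q t d e : Rderiv P t d -> Rderiv Q t e ->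
  Rderiv (fun x => P x + Q x) t (d + e).
Proof.
move=> [p1 p2] [q1 q2]; split.
  have -> : (fun x => complex.Re (P x + Q x)) =
    (fun x => complex.Re (P x)) + (fun x => complex.Re (Q x)).
    by apply/funext => x /=; rewrite fctE; case: (P x) (Q x) => ? ? [].
  by apply: is_derive_eq; case: (d) (e) => ? ? [].
have -> : (fun x => complex.Im (P x + Q x)) =
    (fun x => complex.Im (P x)) + (fun x => complex.Im (Q x)).
  by apply/funext => x /=; rewrite fctE; case: (P x) (Q x) => ? ? [].
by apply: is_derive_eq; case: (d) (e) => ? ? [].
Qed.

Lemma RderivZ (k : C) P t d : Rderiv P t d ->
  Rderiv (fun x => k * P x) t (k * d).
Proof.
case: k => k l [p1 p2]; split.
  have -> : (fun x => complex.Re ((k +i* l : C) * P x)) =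
    k *: (fun x => complex.Re (P x)) - l *: (fun x => complex.Im (P x)).
    by apply/funext => x /=; rewrite !fctE; case: (P x) => ? ?.
  suff -> : complex.Re ((k +i* l : C) * d) =
      k *: complex.Re d - l *: complex.Im d by exact: is_deriveB.
  by case: (d).
have -> : (fun x => complex.Im ((k +i* l : C) * P x)) =
    k *: (fun x => complex.Im (P x)) + l *: (fun x => complex.Re (P x)).
  by apply/funext => x /=; rewrite !fctE; case: (P x) => ? ?.
suff -> : complex.Im ((k +i* l : C) * d) =
    k *: complex.Im d + l *: complex.Re d by exact: is_deriveD.
by case: (d).
Qed.

Definition is_prim P g a b := forall t, a <= t <= b -> Rderiv P t (g t).

Lemma complex_eqP (z w : C) :
  complex.Re z = complex.Re w -> complex.Im z = complex.Im w -> z = w.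
Proof. by case: z w => ? ? [? ?] /= -> ->. Qed.

Lemma ReB (z w : C) : complex.Re (z - w) = complex.Re z - complex.Re w.
Proof. by case: z w => ? ? []. Qed.

Lemma ImB (z w : C) : complex.Im (z - w) = complex.Im z - complex.Im w.
Proof. by case: z w => ? ? []. Qed.

Lemma prim_mean_value_Re P g a b : a <= b -> is_prim P g a b ->
  exists2 c, a <= c <= b &
    complex.Re (P b) - complex.Re (P a) = complex.Re (g c) * (b - a).
Proof.
move=> ab pP; apply: (@derive_mean_value R (fun x => complex.Re (P x))
  (fun x => complex.Re (g x)) a b ab) => t /pP[].
by [].
Qed.

Lemma prim_mean_value_Im P g a b : a <= b -> is_prim P g a b ->
  exists2 c, a <= c <= b &
    complex.Im (P b) - complex.Im (P a) = complex.Im (g c) * (b - a).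
Proof.
move=> ab pP; apply: (@derive_mean_value R (fun x => complex.Im (P x))
  (fun x => complex.Im (g x)) a b ab) => t /pP[].
by [].
Qed.

(** The difference has derivative 0. Real and imaginary parts are treated separately because their
    mean value points differ. This makes [cint] independent of the antiderivative chosen. *)
Lemma prim_unique P Q g a b : a <= b -> is_prim P g a b -> is_prim Q g a b ->
  P b - P a = Q b - Q a.
Proof.
move=> ab pP pQ.
pose D := fun x => P x + (-1) * Q x.
have dD : is_prim D (fun=> 0) a b.
  move=> t tab; apply: Rderiv_eq (RderivD (pP _ tab) (RderivZ _ (pQ _ tab))) _.
  by rewrite mulN1r subrr.
have [c _ e1] := prim_mean_value_Re ab dD.
have [c' _ e2] := prim_mean_value_Im ab dD.
apply/eqP; rewrite -subr_eq0.
have -> : P b - P a - (Q b - Q a) = D b - D a by rewrite /D; ring.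
apply/eqP/complex_eqP; first by rewrite ReB e1 mul0r.
by rewrite ImB e2 mul0r.
Qed.

Lemma prim_exists g a b :
  continuous (fun t => complex.Re (g t)) ->
  continuous (fun t => complex.Im (g t)) -> exists P, is_prim P g a b.
Proof.
move=> /primitive_exists - /(_ a b)[P hP] /primitive_exists - /(_ a b)[Q hQ].
by exists (fun x => P x +i* Q x) => t tab; split; [exact: hP|exact: hQ].
Qed.

(* The increment of a chosen antiderivative; a junk value when there is none. *)
Definition cint g a b : C :=
  let P := xget (fun=> 0) [set P | is_prim P g a b] in P b - P a.

Lemma cintE P g a b : a <= b -> is_prim P g a b -> cint g a b = P b - P a.
Proof.
move=> ab pP; rewrite /cint; apply: (prim_unique (g := g)) => //.
by apply: (xgetPex (fun=> 0) (P := [set P | is_prim P g a b])); exists P.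
Qed.

Definition primable g a b := exists P, is_prim P g a b.

Lemma eq_cint g h a b : a <= b -> (forall t, a <= t <= b -> g t = h t) ->
  cint g a b = cint h a b.
Proof.
move=> ab gh; rewrite /cint.
suff -> : [set P | is_prim P g a b] = [set P | is_prim P h a b] by [].
by apply/seteqP; split => P /= pP t tab;
  [rewrite -gh|rewrite gh] => //; exact: pP.
Qed.

Lemma cintD g h a b : a <= b -> primable g a b -> primable h a b ->
  cint (fun t => g t + h t) a b = cint g a b + cint h a b.
Proof.
move=> ab [P pP] [Q pQ]; rewrite (cintE ab pP) (cintE ab pQ).
rewrite (@cintE (fun t => P t + Q t)) //; first by ring.
by move=> t tab; apply: RderivD; [exact: pP|exact: pQ].
Qed.

Lemma cintZ (k : C) g a b : a <= b -> primable g a b ->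
  cint (fun t => k * g t) a b = k * cint g a b.
Proof.
move=> ab [P pP]; rewrite (cintE ab pP).
rewrite (@cintE (fun t => k * P t)) //; first by ring.
by move=> t tab; apply: RderivZ; exact: pP.
Qed.

Lemma cint_split g a c b : a <= c -> c <= b -> primable g a b ->
  cint g a b = cint g a c + cint g c b.
Proof.
move=> ac cb [P pP].
rewrite (cintE (le_trans ac cb) pP) (@cintE P _ a c) // ?(@cintE P _ c b) //.
- by ring.
- by move=> t /andP[ct tb]; apply: pP; rewrite (le_trans ac ct).
- by move=> t /andP[a_t tc]; apply: pP; rewrite a_t (le_trans tc).
Qed.

Lemma normc_leD (z : C) : normc z <= `|complex.Re z| + `|complex.Im z|.
Proof.
case: z => x y /=.
rewrite -(ler_pXn2r (n := 2)) // ?nnegrE ?addr_ge0 ?sqrtr_ge0 //.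
rewrite sqr_sqrtr ?addr_ge0 ?sqr_ge0 // sqrrD !real_normK ?num_real //.
by rewrite -addrA lerD2l lerDr mulrn_wge0 // mulr_ge0.
Qed.

Lemma Re_le_normc (z : C) : `|complex.Re z| <= normc z.
Proof.
by case: z => x y /=; rewrite -sqrtr_sqr ler_wsqrtr // lerDl sqr_ge0.
Qed.

Lemma Im_le_normc (z : C) : `|complex.Im z| <= normc z.
Proof.
by case: z => x y /=; rewrite -sqrtr_sqr ler_wsqrtr // lerDr sqr_ge0.
Qed.

(** The factor 2 comes from applying the mean value theorem to the real and imaginary parts at two
    unrelated points. *)
Lemma cint_bound g a b M : a <= b -> primable g a b ->
  (forall t, a <= t <= b -> normc (g t) <= M) ->
  normc (cint g a b) <= 2 * M * (b - a).
Proof.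
move=> ab [P pP] gM; rewrite (cintE ab pP).
apply: le_trans (normc_leD _) _.
have [c cab e1] := prim_mean_value_Re ab pP.
have [c' cab' e2] := prim_mean_value_Im ab pP.
have ba0 : 0 <= b - a by rewrite subr_ge0.
rewrite ReB ImB e1 e2 !normrM (ger0_norm ba0) -mulrDl ler_wpM2r //.
have := le_trans (Re_le_normc _) (gM _ cab).
have := le_trans (Im_le_normc _) (gM _ cab').
by lra.
Qed.

(** This bound and the three after it keep the signs that [cint_bound] loses; they serve to show
    that the integral of 1/w around a square is nonzero. *)
Lemma cint_Re_ge g a b m : a <= b -> primable g a b ->
  (forall t, a <= t <= b -> m <= complex.Re (g t)) ->
  m * (b - a) <= complex.Re (cint g a b).
Proof.
move=> ab [P pP] gm; rewrite (cintE ab pP) ReB.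
have [c cab ->] := prim_mean_value_Re ab pP.
by rewrite ler_wpM2r ?subr_ge0 // gm.
Qed.

Lemma cint_Im_ge g a b m : a <= b -> primable g a b ->
  (forall t, a <= t <= b -> m <= complex.Im (g t)) ->
  m * (b - a) <= complex.Im (cint g a b).
Proof.
move=> ab [P pP] gm; rewrite (cintE ab pP) ImB.
have [c cab ->] := prim_mean_value_Im ab pP.
by rewrite ler_wpM2r ?subr_ge0 // gm.
Qed.

Lemma cint_Re_le g a b m : a <= b -> primable g a b ->
  (forall t, a <= t <= b -> complex.Re (g t) <= m) ->
  complex.Re (cint g a b) <= m * (b - a).
Proof.
move=> ab [P pP] gm; rewrite (cintE ab pP) ReB.
have [c cab ->] := prim_mean_value_Re ab pP.
by rewrite ler_wpM2r ?subr_ge0 // gm.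
Qed.

Lemma cint_Im_le g a b m : a <= b -> primable g a b ->
  (forall t, a <= t <= b -> complex.Im (g t) <= m) ->
  complex.Im (cint g a b) <= m * (b - a).
Proof.
move=> ab [P pP] gm; rewrite (cintE ab pP) ImB.
have [c cab ->] := prim_mean_value_Im ab pP.
by rewrite ler_wpM2r ?subr_ge0 // gm.
Qed.

End ComplexIntegral.

(** * Complex differentiability *)

Section EpsilonDelta.

(** Once the denominator is cleared, the estimate holds trivially at [w = x], so full neighbourhoods
    can replace punctured ones. *)
Lemma is_deriveP (K : numFieldType) (f : K -> K) (x d : K) :
  is_derive x 1 f d <->
  forall e : K, 0 < e -> \forall w \near x,
    `|f w - f x - d * (w - x)| <= e * `|w - x|.
Proof.
have slope (h : K) : h != 0 -> h^-1 *: (f (h *: 1 + x) - f x) - d =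
    (f (x + h) - f x - d * h) / h.
  move=> h0; have -> : h *: (1 : K) + x = x + h.
    by rewrite addrC /GRing.scale /= mulr1.
  by rewrite mulrBl mulfK // mulrC.
have dE (e h : K) : h != 0 -> (`|d - h^-1 *: (f (h *: 1 + x) - f x)| <= e) =
    (`|f (x + h) - f x - d * h| <= e * `|h|).
  by move=> h0; rewrite distrC slope // normrM normfV ler_pdivrMr // normr_gt0.
split => [[df dfE] /= e e0|H].
  have /cvgrPdist_le/(_ _ e0) :
    h^-1 *: (f (h *: 1 + x) - f x) @[h --> 0^'] --> 'D_1 f x by [].
  rewrite near_withinE near_simpl dfE => H; apply/nbhs0P.
  apply: filterS H => h /= H; rewrite [x + h]addrC addrK addrC.
  have [->|h0] := eqVneq h 0; last by rewrite -dE // H.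
  by rewrite addr0 subrr mulr0 subr0 normr0 mulr0.
have cvd : h^-1 *: (f (h *: 1 + x) - f x) @[h --> 0^'] --> d.
  apply/cvgrPdist_le => e e0; rewrite near_withinE near_simpl.
  have /nbhs0P := H _ e0; apply: filterS => h /= + h0.
  by rewrite [x + h]addrC addrK addrC dE.
by apply: DeriveDef; [apply/cvg_ex; exists d|exact: cvg_lim].
Qed.

Section PointwiseDerivative.
Variable K : numFieldType.
Implicit Types (f g : K -> K) (x a b c : K).

Lemma der_eq f x a b : is_derive x 1 f a -> a = b -> is_derive x 1 f b.
Proof. by move=> ? <-. Qed.

Lemma der_cst c x : is_derive x 1 (fun=> c) (0 : K).
Proof. exact: is_derive_cst. Qed.

Lemma der_id x : is_derive x 1 (fun w : K => w) (1 : K).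
Proof. exact: is_derive_id. Qed.

Lemma derD f g x a b : is_derive x 1 f a -> is_derive x 1 g b ->
  is_derive x 1 (fun w => f w + g w) (a + b).
Proof. exact: is_deriveD. Qed.

Lemma derB f g x a b : is_derive x 1 f a -> is_derive x 1 g b ->
  is_derive x 1 (fun w => f w - g w) (a - b).
Proof. exact: is_deriveB. Qed.

Lemma derM f g x a b : is_derive x 1 f a -> is_derive x 1 g b ->
  is_derive x 1 (fun w => f w * g w) (a * g x + f x * b).
Proof.
move=> df dg; have -> : a * g x + f x * b = f x *: b + g x *: a.
  by rewrite /GRing.scale /= addrC [a * _]mulrC.
exact: is_deriveM.
Qed.

Lemma derZ c f x a : is_derive x 1 f a -> is_derive x 1 (fun w => c * f w) (c * a).
Proof.
by move=> df; apply: der_eq (derM (der_cst c x) df) _; rewrite mul0r add0r.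
Qed.

Lemma derX f n x a : is_derive x 1 f a ->
  is_derive x 1 (fun w => f w ^+ n.+1) (n.+1%:R * f x ^+ n * a).
Proof.
move=> df; elim: n => [|n IH].
  by apply: der_eq df _; rewrite expr0 !mul1r.
have -> : (fun w => f w ^+ n.+2) = (fun w => f w * f w ^+ n.+1).
  by apply/funext => w; rewrite exprS.
apply: der_eq (derM df IH) _.
by rewrite -[in RHS]natr1 !exprS; ring.
Qed.

Lemma derV f x a : f x != 0 -> is_derive x 1 f a ->
  is_derive x 1 (fun w => (f w)^-1) (- a / f x ^+ 2).
Proof.
move=> fx0 [df dfE]; apply: DeriveDef; first exact: derivableV.
by rewrite deriveV // dfE /GRing.scale /= mulNr mulNr mulrC.
Qed.

Lemma der_comp f g x a b : is_derive (g x) 1 f a -> is_derive x 1 g b ->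
  is_derive x 1 (fun w => f (g w)) (a * b).
Proof.
move=> [/derivable1_diffP df dfE] [/derivable1_diffP dg dgE].
have dfg : differentiable (f \o g) x by exact: differentiable_comp.
apply: DeriveDef; first exact/derivable1_diffP.
rewrite deriveE // diff_comp //= -[X in 'd f _ X]mulr1 -dgE (deriveE _ dg).
have -> : 'd g x 1 * 1 = 'd g x 1 *: (1 : K) by [].
rewrite linearZ -dfE (deriveE _ df).
exact: mulrC.
Qed.

Lemma der_continuous f x a : is_derive x 1 f a -> {for x, continuous f}.
Proof. by move=> [df _]; apply/differentiable_continuous/derivable1_diffP. Qed.

End PointwiseDerivative.

Lemma continuous_atP (K : numFieldType) (f : K -> K) (x : K) :
  {for x, continuous f} <->
  forall e : K, 0 < e -> \forall w \near x, `|f x - f w| < e.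
Proof. exact: (@cvgrPdist_lt K K K (nbhs x) (nbhs_filter x) f (f x)). Qed.

Lemma near_dist (K : numFieldType) (x d : K) (P : K -> Prop) : 0 < d ->
  (forall w, `|x - w| < d -> P w) -> \forall w \near x, P w.
Proof. by move=> d0 H; apply/nbhs_ballP; exists d. Qed.

Variable R : realType.
Local Notation C := (CC R).

Lemma nearCP (z : C) (P : C -> Prop) :
  (\forall w \near z, P w) <->
  exists2 d : R, 0 < d & forall w : C, normc (w - z) < d -> P w.
Proof.
split=> [/nbhs_ballP[e /= e0 H]|[d d0 H]].
  (* In the order of [R[i]] a positive element is real, so a complex radius is a real one. *)
  have e_real : e = (complex.Re e)%:C by rewrite RRe_real // gtr0_real.
  exists (complex.Re e); first by move: e0; rewrite e_real ltcR.
  move=> w wz; apply: H; rewrite -ball_normE /ball_ /=.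
  by rewrite distrC CnormE e_real ltcR.
apply/nbhs_ballP; exists (d%:C : C); first by rewrite /= ltcR.
by move=> w; rewrite -ball_normE /ball_ /= distrC CnormE ltcR => /H.
Qed.

Lemma continuousCP (f : C -> C) (z : C) :
  {for z, continuous f} <->
  forall e : R, 0 < e -> exists2 d : R, 0 < d &
    forall w, normc (w - z) < d -> normc (f w - f z) < e.
Proof.
split=> [/continuous_atP H e e0|H].
  have /nearCP[d d0 Hd] := H (e%:C : C) ltac:(by rewrite ltcR).
  by exists d => // w /Hd; rewrite distrC CnormE ltcR.
apply/continuous_atP => /= e e0.
have e_real : e = (complex.Re e)%:C by rewrite RRe_real // gtr0_real.
have [|d d0 Hd] := H (complex.Re e); first by move: e0; rewrite e_real ltcR.
apply/nearCP; exists d => // w /Hd; rewrite distrC CnormE.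
by rewrite [in X in _ -> X]e_real ltcR.
Qed.

Lemma is_deriveCP (f : C -> C) (z d : C) :
  is_derive z 1 f d <->
  forall e : R, 0 < e -> exists2 r : R, 0 < r &
    forall w, normc (w - z) < r ->
      normc (f w - f z - d * (w - z)) <= e * normc (w - z).
Proof.
rewrite is_deriveP; split=> [H e e0|H e e0].
  have /nearCP[r r0 Hr] := H (e%:C : C) ltac:(by rewrite ltcR).
  by exists r => // w /Hr; rewrite !CnormE -rmorphM lecR.
have e_real : e = (complex.Re e)%:C by rewrite RRe_real // gtr0_real.
have [|r r0 Hr] := H (complex.Re e); first by move: e0; rewrite e_real ltcR.
apply/nearCP; exists r => // w /Hr; rewrite !CnormE.
by rewrite [in X in _ -> X]e_real -rmorphM lecR.
Qed.

Lemma line_continuous (f : C -> C) (l : R -> C) (t : R) :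
  (forall t t', normc (l t - l t') <= `|t - t'|) ->
  {for l t, continuous f} ->
  {for t, continuous (fun t => complex.Re (f (l t)))} /\
  {for t, continuous (fun t => complex.Im (f (l t)))}.
Proof.
move=> lip /continuousCP cf.
split; apply/continuous_atP => e e0; have [d d0 Hd] := cf e e0;
  apply: (near_dist d0) => t' tt';
  have := Hd (l t') (le_lt_trans (lip _ _) _); rewrite distrC => /(_ tt').
  by apply: le_lt_trans; rewrite distrC -ReB Re_le_normc.
by apply: le_lt_trans; rewrite distrC -ImB Im_le_normc.
Qed.

(** Because [normc u <= 1], a radius that works for [F] at the base point works for the real
    parameter too. Only the directions 1 and 'i are used. *)
Lemma line_Rderiv (F : C -> C) (z u d : C) (t : R) : normc u <= 1 ->
  is_derive (z + t%:C * u) 1 F d ->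
  Rderiv (fun t => F (z + t%:C * u)) t (u * d).
Proof.
move=> u1 /is_deriveCP dF.
have key e : 0 < e -> \forall t' \near t,
      normc (F (z + t'%:C * u) - F (z + t%:C * u) - d * u * (t' - t)%:C) <=
      e * `|t' - t|.
  move=> e0; have [r r0 Hr] := dF e e0.
  apply: (near_dist r0) => t' tt'.
  have E : z + t'%:C * u - (z + t%:C * u) = (t' - t)%:C * u :> C.
    by rewrite rmorphB /=; ring.
  have E2 : normc ((t' - t)%:C * u) <= `|t' - t|.
    rewrite normcM [X in X * _ <= _](_ : _ = `|t' - t|).
      by rewrite ler_piMr.
    by rewrite /= expr0n addr0 sqrtr_sqr.
  have := Hr (z + t'%:C * u); rewrite E => /(_ _)/le_trans.
  rewrite -mulrA [u * _]mulrC; apply; last by rewrite ler_pM2l.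
  by apply: le_lt_trans E2 _; rewrite distrC.
split; apply/is_deriveP => e e0; have := key e e0; apply: filterS => t' H;
  apply: le_trans H.
  apply: le_trans (Re_le_normc _); rewrite !ReB le_eqVlt; apply/orP; left.
  apply/eqP; congr (`|_ - _|).
  case: (u) (d) => a b [a' b'] /=.
  by rewrite mulr0 subr0 [a * a']mulrC [b * b']mulrC.
apply: le_trans (Im_le_normc _); rewrite !ImB le_eqVlt; apply/orP; left.
apply/eqP; congr (`|_ - _|).
by case: (u) (d) => a b [a' b'] /=; ring.
Qed.

End EpsilonDelta.

(** * Integrals along squares *)

Section SquareIntegral.
Variable R : realType.
Local Notation C := (CC R).
Implicit Types (f g F : C -> C) (x y s t : R).

(* The four full lines carrying the sides, not only the sides. *)
Definition frame x y s (w : C) :=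
  [\/ complex.Re w = x, complex.Re w = x + s,
      complex.Im w = y | complex.Im w = y + s].

Definition in_square x y s (w : C) :=
  (x <= complex.Re w <= x + s) && (y <= complex.Im w <= y + s).

(** Whole lines are involved because [prim_exists] produces antiderivatives only for functions
    continuous on all of [R]. *)
Definition frame_continuous f x y s :=
  forall w, frame x y s w -> {for w, continuous f}.

Definition horizontal_line y t : C := t +i* y.
Definition vertical_line x t : C := x +i* t.

(** The counterclockwise contour integral over the square with lower left corner x + iy and side s;
    the factor 'i is dw = i dt on the vertical sides. *)
Definition oint f x y s : C :=
  cint (f \o horizontal_line y) x (x + s) -
  cint (f \o horizontal_line (y + s)) x (x + s) +
  'i * (cint (f \o vertical_line (x + s)) y (y + s) -
        cint (f \o vertical_line x) y (y + s)).

Lemma ointE f x y s : oint f x y s =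
  cint (f \o horizontal_line y) x (x + s) -
  cint (f \o horizontal_line (y + s)) x (x + s) +
  'i * (cint (f \o vertical_line (x + s)) y (y + s) -
        cint (f \o vertical_line x) y (y + s)).
Proof. by []. Qed.

Lemma hline_prim F f y a b :
  (forall t, a <= t <= b ->
    is_derive (horizontal_line y t) 1 F (f (horizontal_line y t))) ->
  is_prim (F \o horizontal_line y) (f \o horizontal_line y) a b.
Proof.
move=> dF t tab.
have E t' : horizontal_line y t' = (0 +i* y) + t'%:C * 1 :> C.
  by apply: complex_eqP; rewrite /horizontal_line /=
    ?mulr0 ?mulr1 ?subr0 ?addr0 ?add0r.
have -> : F \o horizontal_line y = fun t => F ((0 +i* y : C) + (t%:C : C) * 1).
  by apply/funext => t' /=; rewrite E.
apply: Rderiv_eq; last exact: mul1r.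
apply: line_Rderiv; first by rewrite normc1.
by rewrite -E; exact: dF.
Qed.

(** Along a vertical line the real derivative of [F] is i f, and the factor - 'i undoes this. *)
Lemma vline_prim F f x a b :
  (forall t, a <= t <= b ->
    is_derive (vertical_line x t) 1 F (f (vertical_line x t))) ->
  is_prim (fun t => - 'i * F (vertical_line x t)) (f \o vertical_line x) a b.
Proof.
move=> dF t tab.
have E t' : vertical_line x t' = x%:C + t'%:C * 'i :> C.
  by apply: complex_eqP; rewrite /vertical_line /=
    ?mulr0 ?mulr1 ?mul0r ?subr0 ?addr0 ?add0r.
have -> : (fun t => - 'i * F (vertical_line x t)) =
    fun t => - 'i * F ((x%:C : C) + (t%:C : C) * 'i).
  by apply/funext => t' /=; rewrite E.
apply: Rderiv_eq.
  apply: RderivZ; apply: line_Rderiv; last by rewrite -E; exact: dF.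
  by rewrite /= expr0n add0r expr1n sqrtr1.
by rewrite mulrA mulNr -expr2 sqr_i opprK mul1r.
Qed.

Lemma hline_primable f y a b :
  (forall t, {for horizontal_line y t, continuous f}) ->
  primable (f \o horizontal_line y) a b.
Proof.
move=> cf; apply: prim_exists => t.
- apply: (@line_continuous R f (horizontal_line y) t _ (cf t)).1 => t1 t2.
  by rewrite /= subrr [0 ^+ _]expr0n addr0 sqrtr_sqr.
- apply: (@line_continuous R f (horizontal_line y) t _ (cf t)).2 => t1 t2.
  by rewrite /= subrr [0 ^+ _]expr0n addr0 sqrtr_sqr.
Qed.

Lemma vline_primable f x a b :
  (forall t, {for vertical_line x t, continuous f}) ->
  primable (f \o vertical_line x) a b.
Proof.
move=> cf; apply: prim_exists => t.
- apply: (@line_continuous R f (vertical_line x) t _ (cf t)).1 => t1 t2.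
  by rewrite /= subrr [0 ^+ _]expr0n add0r sqrtr_sqr.
- apply: (@line_continuous R f (vertical_line x) t _ (cf t)).2 => t1 t2.
  by rewrite /= subrr [0 ^+ _]expr0n add0r sqrtr_sqr.
Qed.

Lemma frame_primable f x y s a b : frame_continuous f x y s ->
  [/\ primable (f \o horizontal_line y) a b,
      primable (f \o horizontal_line (y + s)) a b,
      primable (f \o vertical_line x) a b &
      primable (f \o vertical_line (x + s)) a b].
Proof.
move=> cf; split; [apply: hline_primable|apply: hline_primable|
  apply: vline_primable|apply: vline_primable] => t; apply: cf => /=.
- by apply: Or43.
- by apply: Or44.
- by apply: Or41.
- by apply: Or42.
Qed.

Lemma oint_deriv F f x y s : 0 <= s ->
  (forall w, frame x y s w -> is_derive w 1 F (f w)) -> oint f x y s = 0.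
Proof.
move=> s0 dF; rewrite /oint.
have xs : x <= x + s by rewrite lerDl.
have ys : y <= y + s by rewrite lerDl.
have E3 := cintE xs
  (hline_prim (fun t _ => dF (horizontal_line y t) (Or43 _ _ _ erefl))).
have E4 := cintE xs
  (hline_prim (fun t _ => dF (horizontal_line (y + s) t) (Or44 _ _ _ erefl))).
have E2 := cintE ys
  (vline_prim (fun t _ => dF (vertical_line (x + s) t) (Or42 _ _ _ erefl))).
have E1 := cintE ys
  (vline_prim (fun t _ => dF (vertical_line x t) (Or41 _ _ _ erefl))).
rewrite E1 E2 E3 E4 /=.
(* Each corner lies on two of the lines; naming it once turns the eight endpoint values of [F] into
   four, which cancel by i^2 = -1. *)
have -> : vertical_line (x + s) (y + s) = horizontal_line (y + s) (x + s) by [].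
have -> : vertical_line (x + s) y = horizontal_line y (x + s) by [].
have -> : vertical_line x (y + s) = horizontal_line (y + s) x by [].
have -> : vertical_line x y = horizontal_line y x by [].
set A := F _; set B := F _; set D := F _; set E := F _.
have ii : ('i : C) * 'i = -1 by rewrite -expr2 sqr_i.
transitivity ((A - B - (D - E)) - ('i * 'i : C) * (D - A - (E - B))); first by ring.
by rewrite ii; ring.
Qed.

(** The constant 8 is four sides times the factor 2 of [cint_bound]. *)
Lemma oint_bound f x y s M : 0 <= s -> frame_continuous f x y s ->
  (forall w, frame x y s w -> in_square x y s w -> normc (f w) <= M) ->
  normc (oint f x y s) <= 8 * M * s.
Proof.
move=> s0 cf fM; rewrite /oint.
have [p1 p2 _ _] := @frame_primable f x y s x (x + s) cf.
have [_ _ p3 p4] := @frame_primable f x y s y (y + s) cf.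
have xs : x <= x + s by rewrite lerDl.
have ys : y <= y + s by rewrite lerDl.
apply: le_trans (ler_normcD _ _) _.
rewrite normcMC.
have -> : normc ('i : C) = 1 by rewrite /= expr0n add0r expr1n sqrtr1.
rewrite mul1r.
have B1 : normc (cint (f \o horizontal_line y) x (x + s)) <= 2 * M * (x + s - x).
  apply: cint_bound => // t tt; apply: fM; first exact: Or43.
  by rewrite /in_square /= tt lexx ys.
have B2 : normc (cint (f \o horizontal_line (y + s)) x (x + s)) <= 2 * M * (x + s - x).
  apply: cint_bound => // t tt; apply: fM; first exact: Or44.
  by rewrite /in_square /= tt lexx ys.
have B3 : normc (cint (f \o vertical_line x) y (y + s)) <= 2 * M * (y + s - y).
  apply: cint_bound => // t tt; apply: fM; first exact: Or41.
  by rewrite /in_square /= tt lexx xs.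
have B4 : normc (cint (f \o vertical_line (x + s)) y (y + s)) <= 2 * M * (y + s - y).
  apply: cint_bound => // t tt; apply: fM; first exact: Or42.
  by rewrite /in_square /= tt lexx xs.
have := ler_normcD (cint (f \o horizontal_line y) x (x + s))
  (- cint (f \o horizontal_line (y + s)) x (x + s)).
have := ler_normcD (cint (f \o vertical_line (x + s)) y (y + s))
  (- cint (f \o vertical_line x) y (y + s)).
rewrite !normcNC.
move: B1 B2 B3 B4; rewrite ![_ + s]addrC !addrK; lra.
Qed.

Lemma ointD f g x y s : 0 <= s -> frame_continuous f x y s ->
  frame_continuous g x y s ->
  oint (fun w => f w + g w) x y s = oint f x y s + oint g x y s.
Proof.
move=> s0 cf cg; rewrite /oint.
have [p1 p2 _ _] := @frame_primable f x y s x (x + s) cf.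
have [_ _ p3 p4] := @frame_primable f x y s y (y + s) cf.
have [q1 q2 _ _] := @frame_primable g x y s x (x + s) cg.
have [_ _ q3 q4] := @frame_primable g x y s y (y + s) cg.
have xs : x <= x + s by rewrite lerDl.
have ys : y <= y + s by rewrite lerDl.
rewrite (cintD xs p1 q1) (cintD xs p2 q2) (cintD ys p3 q3) (cintD ys p4 q4).
by ring.
Qed.

Lemma ointZ (k : C) f x y s : 0 <= s -> frame_continuous f x y s ->
  oint (fun w => k * f w) x y s = k * oint f x y s.
Proof.
move=> s0 cf; rewrite /oint.
have [p1 p2 _ _] := @frame_primable f x y s x (x + s) cf.
have [_ _ p3 p4] := @frame_primable f x y s y (y + s) cf.
have xs : x <= x + s by rewrite lerDl.
have ys : y <= y + s by rewrite lerDl.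
rewrite (cintZ _ xs p1) (cintZ _ xs p2) (cintZ _ ys p3) (cintZ _ ys p4).
by ring.
Qed.

Lemma eq_oint f g x y s : 0 <= s ->
  (forall w, frame x y s w -> in_square x y s w -> f w = g w) ->
  oint f x y s = oint g x y s.
Proof.
move=> s0 fg; rewrite /oint.
have xs : x <= x + s by rewrite lerDl.
have ys : y <= y + s by rewrite lerDl.
congr (_ - _ + _ * (_ - _)); apply: eq_cint => // t tt; apply: fg;
  rewrite /in_square /= ?tt ?lexx ?xs ?ys //.
- exact: Or43.
- exact: Or44.
- exact: Or42.
- exact: Or41.
Qed.

(** Every inner side belongs to two quarters with opposite orientations and cancels; the outer sides
    are halved by [cint_split]. *)
Lemma oint_quarter f x y h : 0 <= h -> continuous f ->
  oint f x y (h + h) = oint f x y h + oint f (x + h) y h +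
    oint f x (y + h) h + oint f (x + h) (y + h) h.
Proof.
move=> h0 cf; rewrite /oint ![_ + (h + h)]addrA.
have le z : z <= z + h by rewrite lerDl.
have pH z a b : primable (f \o horizontal_line z) a b.
  by apply: hline_primable => t; exact: cf.
have pV z a b : primable (f \o vertical_line z) a b.
  by apply: vline_primable => t; exact: cf.
have sH z := cint_split (le x) (le (x + h)) (pH z x (x + h + h)).
have sV z := cint_split (le y) (le (y + h)) (pV z y (y + h + h)).
rewrite !sH !sV.
by ring.
Qed.

End SquareIntegral.

(** * Goursat's theorem *)

Section Bisection.
Variable R : realType.

Lemma nested_intervals_point (a b : nat -> R) :
  (forall n, a n <= a n.+1) -> (forall n, b n.+1 <= b n) ->
  (forall n, a n <= b n) -> exists c, forall n, a n <= c <= b n.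
Proof.
move=> ia ib ab.
have ai m n : (m <= n)%N -> a m <= a n by exact: (homo_leq (f := a) lexx le_trans ia).
have bi m n : (m <= n)%N -> b n <= b m.
  by move=> mn; apply: (homo_leq (r := fun u v : R => v <= u) (f := b)) mn => //
    u v w vu wv; exact: le_trans wv vu.
have am_bn m n : a m <= b n.
  apply: le_trans (ai _ _ (leq_maxl m n)) (le_trans (ab _) (bi _ _ (leq_maxr m n))).
exists (sup (range a)) => n; apply/andP; split.
  apply: ub_le_sup; last by exists n.
  by exists (b 0%N) => _ [m _ <-].
apply: ge_sup; first by exists (a 0%N), 0%N.
by move=> _ [m _ <-].
Qed.

(** Goursat's subdivision for an arbitrary property: passing to a quarter again and again gives
    nested intervals in each coordinate, and their common point is the point of concentration. *)
Lemma square_bisection (P : R -> R -> R -> Prop) (x y s : R) : 0 < s ->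
  P x y s ->
  (forall x y h, 0 < h -> P x y (h + h) ->
    [\/ P x y h, P (x + h) y h, P x (y + h) h | P (x + h) (y + h) h]) ->
  exists u v, [/\ x <= u <= x + s, y <= v <= y + s &
    forall e, 0 < e -> exists a b t,
      [/\ 0 < t < e, a <= u <= a + t, b <= v <= b + t & P a b t]].
Proof.
move=> s0 P0 step.
pose ok (q : R * R * R) := 0 < q.2 /\ P q.1.1 q.1.2 q.2.
pose nxt (q r : R * R * R) := [/\ r.2 = q.2 / 2,
  (q.1.1 <= r.1.1) && (r.1.1 + r.2 <= q.1.1 + q.2),
  (q.1.2 <= r.1.2) && (r.1.2 + r.2 <= q.1.2 + q.2) & ok r].
(* The choice has to be total in order to be iterated; on a triple that fails [ok] the condition is
   void and the triple itself is returned. *)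
have ex q : {r | ok q -> nxt q r}.
  apply: cid; have [[q0 Pq]|nok] := pselect (ok q); last by exists q.
  case: q q0 Pq => [[a b] t] /= t0 Pt.
  have h0 : 0 < t / 2 by rewrite divr_gt0.
  have ht : t = t / 2 + t / 2 by lra.
  rewrite ht in Pt.
  case: (step _ _ _ h0 Pt) => Pr; [exists (a, b, t/2)|exists (a + t/2, b, t/2)|
    exists (a, b + t/2, t/2)|exists (a + t/2, b + t/2, t/2)] => _;
    (split => //=; lra).
pose f q := sval (ex q).
pose q n := iter n f (x, y, s).
have okq n : ok (q n).
  by elim: n => [//|n IH]; have [] := svalP (ex (q n)) IH.
have nq n : nxt (q n) (q n.+1) := svalP (ex (q n)) (okq n).
have [n|n|n|u hu] := @nested_intervals_point (fun n => (q n).1.1)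
    (fun n => (q n).1.1 + (q n).2).
- by have [_ /andP[]] := nq n.
- by have [_ /andP[]] := nq n.
- by have [h _] := okq n; rewrite lerDl ltW.
have [n|n|n|v hv] := @nested_intervals_point (fun n => (q n).1.2)
    (fun n => (q n).1.2 + (q n).2).
- by have [_ _ /andP[]] := nq n.
- by have [_ _ /andP[]] := nq n.
- by have [h _] := okq n; rewrite lerDl ltW.
exists u, v; split; [exact: (hu 0%N)|exact: (hv 0%N)|] => e e0.
have qs n : (q n).2 = s / 2 ^+ n.
  elim: n => [|n IH]; first by rewrite expr0 divr1.
  by have [-> _ _ _] := nq n; rewrite IH exprS; field; rewrite expf_neq0.
(* Any n above s/e works, since 2^n > n. *)
have [n hn] : exists n, s / 2 ^+ n < e.
  exists (Num.trunc (s / e)).+1.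
  rewrite ltr_pdivrMr ?exprn_gt0 // mulrC -ltr_pdivrMr //.
  apply: lt_le_trans (truncnS_gt _) _.
  by rewrite -natrX ler_nat ltnW // ltn_expl.
exists (q n).1.1, (q n).1.2, (q n).2; have [h Pn] := okq n; split => //.
by rewrite h qs.
Qed.

End Bisection.

Section Goursat.
Variable R : realType.
Local Notation C := (CC R).

Lemma is_derive_affine_prim (c d w0 w : C) :
  is_derive w 1 (fun w => c * w + d / 2 * (w - w0) ^+ 2) (c + d * (w - w0)).
Proof.
apply: der_eq (derD (derZ c (der_id w))
  (derZ (d / 2) (derX 1 (derB (der_id w) (der_cst w0 w))))) _.
by field.
Qed.

(** As [Num.sqrt] is 0 on negative reals, this is the increasing odd function sgn(t) |t|^(1/2). Over
    an interval of length t containing 0 it grows by at least the square root of t, so a product of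
    two such increments is at least t. *)
Let g (t : R) : R := Num.sqrt t - Num.sqrt (- t).

Let g_mono : {homo g : a b / a <= b}.
Proof. by move=> a b ab; rewrite lerB // ler_wsqrtr // lerN2. Qed.

Let g_ge (a b : R) : a <= 0 <= b -> Num.sqrt (b - a) <= g b - g a.
Proof.
move=> /andP[a0 b0].
have -> : g b - g a = Num.sqrt b + Num.sqrt (- a).
  by rewrite /g (@ler0_sqrtr _ (- b)) ?oppr_le0 // (@ler0_sqrtr _ a) //; ring.
(* After squaring, the two sides differ only by the nonnegative cross term of the two roots. *)
rewrite -(ler_pXn2r (n := 2)) // ?nnegrE ?addr_ge0 ?sqrtr_ge0 //.
rewrite sqrrD !sqr_sqrtr ?oppr_ge0 // ?subr_ge0 ?(le_trans a0) //.
have := mulr_ge0 (sqrtr_ge0 b) (sqrtr_ge0 (- a)).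
by rewrite -mulr_natr; lra.
Qed.

(* [m] is additive under subdivision; its [g]-part is a product of two Stieltjes
   increments whose value on a square of side [t] around [z0] is at least [t],
   which beats the continuity estimate o(t) available at [z0]. *)
Lemma goursat_square (f : C -> C) (x y s : R) (z0 : C) : 0 < s -> continuous f ->
  (forall w, in_square x y s w -> w != z0 -> derivable f w 1) ->
  oint f x y s = 0.
Proof.
move=> s0 cf df; apply/eqP; rewrite -normc_eq0C; apply: contraT => n0.
have N0 : 0 < normc (oint f x y s) by rewrite lt_def n0 normc_ge0.
pose G (a x s : R) := g (x + s - a) - g (x - a).
pose m x y s := s * s + G (complex.Re z0) x s * G (complex.Im z0) y s.
have G0 a u h : 0 <= h -> 0 <= G a u h.
  by move=> h0; rewrite subr_ge0; apply: g_mono; rewrite lerD2r lerDl.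
have m0 : 0 < m x y s.
  by rewrite ltr_wpDr ?mulr_gt0 // mulr_ge0 // G0 // ltW.
(* Half of the ratio, so that the initial square satisfies the strict inequality [P]. *)
pose eta := normc (oint f x y s) / m x y s / 2.
have eta0 : 0 < eta by rewrite !divr_gt0.
pose P x y s := eta * m x y s < normc (oint f x y s).
have P0 : P x y s.
  rewrite /P /eta; have -> : normc (oint f x y s) / m x y s / 2 * m x y s =
    normc (oint f x y s) / 2 by field; exact: lt0r_neq0.
  by lra.
(* The integral and [m] are both additive over quarters, so four quarters violating [P] would make
   the whole square violate it. *)
have step x' y' h : 0 < h -> P x' y' (h + h) ->
    [\/ P x' y' h, P (x' + h) y' h, P x' (y' + h) h | P (x' + h) (y' + h) h].
  move=> h0; rewrite {1}/P (oint_quarter _ _ (ltW h0) cf).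
  case: (ltP (eta * m x' y' h) (normc (oint f x' y' h))) => [|H1];
    first by move=> + _; apply: Or41.
  case: (ltP (eta * m (x' + h) y' h) (normc (oint f (x' + h) y' h))) => [|H2];
    first by move=> + _; apply: Or42.
  case: (ltP (eta * m x' (y' + h) h) (normc (oint f x' (y' + h) h))) => [|H3];
    first by move=> + _; apply: Or43.
  case: (ltP (eta * m (x' + h) (y' + h) h)
    (normc (oint f (x' + h) (y' + h) h))) => [|H4];
    first by move=> + _; apply: Or44.
  set A := oint _ _ _ _ in H1 *; set B := oint _ _ _ _ in H2 *.
  set D := oint _ _ _ _ in H3 *; set E := oint _ _ _ _ in H4 *.
  have := ler_normcD (A + B + D) E; have := ler_normcD (A + B) D; have := ler_normcD A B.
  have -> : m x' y' (h + h) = m x' y' h + m (x' + h) y' h + m x' (y' + h) h +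
      m (x' + h) (y' + h) h.
    by rewrite /m /G ![_ + (h + h)]addrA; ring.
  move=> h1 h2 h3 h4; exfalso; move: H1 H2 H3 H4 h1 h2 h3 h4.
  move: (m x' y' h) (m (x' + h) y' h) (m x' (y' + h) h) (m (x' + h) (y' + h) h).
  by clear; move=> m1 m2 m3 m4; lra.
have [u [v [hu hv loc]]] := square_bisection s0 P0 step.
have dist a b t (w : C) : a <= u <= a + t -> b <= v <= b + t -> in_square a b t w ->
    normc (w - (u +i* v)) <= 2 * t.
  case: w => w1 w2 h1 h2; move=> /andP[h3 h4].
  apply: le_trans (normc_leD _) _ => /=; move: h3 h4 => /= h3 h4.
  have : `|w1 - u| <= t by rewrite ler_norml; apply/andP; split; lra.
  have : `|w2 - v| <= t by rewrite ler_norml; apply/andP; split; lra.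
  by lra.
(* An affine function has an antiderivative, so subtracting one leaves the integral unchanged. *)
have affine (c d w0 : C) a b t : 0 <= t ->
    oint (fun w => f w - (c + d * (w - w0))) a b t = oint f a b t.
  move=> t0.
  have ca : continuous (fun w : C => c + d * (w - w0)).
    move=> w; apply: (der_continuous (derD (der_cst c w)
      (derZ d (derB (der_id w) (der_cst w0 w))))).
  have -> : (fun w : C => f w - (c + d * (w - w0))) =
      fun w => f w + (-1) * (c + d * (w - w0)).
    by apply/funext => w; rewrite mulN1r.
  have cfr : frame_continuous f a b t by move=> w _; exact: cf.
  rewrite (ointD t0 cfr); last first.
  - move=> w _; apply: continuousM; [exact: cst_continuous|exact: ca].
  have cafr : frame_continuous (fun w : C => c + d * (w - w0)) a b t.
    by move=> w _; exact: ca.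
  rewrite (ointZ _ t0 cafr).
  by rewrite (oint_deriv t0 (fun w _ => is_derive_affine_prim c d w0 w)) mulr0 addr0.
have cfa (c d w0 : C) a b t :
    frame_continuous (fun w : C => f w - (c + d * (w - w0))) a b t.
  move=> w _; apply: continuousB; first exact: cf.
  apply: continuousD; first exact: cst_continuous.
  apply: continuousM; first exact: cst_continuous.
  by apply: continuousB; [exact: id|exact: cst_continuous].
have [uv|uv] := eqVneq (u +i* v : C) z0.
(* At the exceptional point only the constant [f z0] can be subtracted. Points of the square are
   within 2t of it, so a side below d/2 keeps the error below eta/8, and [oint_bound] gives eta t,
   which the [G] part of [m] dominates. *)
- have e0 : 0 < eta / 8 by rewrite divr_gt0.
  have [d d0 Hd] := (continuousCP f z0).1 (cf z0) _ e0.
  have [a [b [t [/andP[t0 td] ha hb]]]] := loc _ (divr_gt0 d0 (ltr0n _ 2)).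
  rewrite /P => Pt; suff : normc (oint f a b t) <= eta * m a b t by rewrite leNgt Pt.
  rewrite -(affine (f z0) 0 0 a b t (ltW t0)).
  apply: le_trans (oint_bound (M := eta / 8) (ltW t0) (cfa _ _ _ _ _ _) _) _.
    move=> w _ wQ; rewrite mul0r addr0 ltW // Hd // -uv.
    by apply: le_lt_trans (dist _ _ _ _ ha hb wQ) _; lra.
  have GG : t <= G (complex.Re z0) a t * G (complex.Im z0) b t.
    have := sqr_sqrtr (ltW t0); rewrite expr2 => {1}<-.
    rewrite -uv /=.
    apply: ler_pM; rewrite ?sqrtr_ge0 //.
      apply: le_trans (g_ge _); last by apply/andP; split; lra.
      by rewrite le_eqVlt; apply/orP; left; apply/eqP; congr Num.sqrt; ring.
    apply: le_trans (g_ge _); last by apply/andP; split; lra.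
    by rewrite le_eqVlt; apply/orP; left; apply/eqP; congr Num.sqrt; ring.
  rewrite (_ : 8 * (eta / 8) * t = eta * t); last by field.
  by rewrite ler_pM2l // /m; apply: le_trans GG _; rewrite lerDr mulr_ge0 // ltW.
have uvQ : in_square x y s (u +i* v : C) by rewrite /in_square /= hu hv.
have [d dfw] : exists d, is_derive (u +i* v : C) 1 f d.
  by exists ('D_1 f (u +i* v : C)); exact/derivableP/df.
(* At a point of differentiability the error is at most (eta/16)(2t), so [oint_bound] gives eta t^2,
   covered by the area term of [m]. *)
have e0 : 0 < eta / 16 by rewrite divr_gt0.
have [r r0 Hr] := (is_deriveCP f (u +i* v) d).1 dfw _ e0.
have [a [b [t [/andP[t0 td] ha hb]]]] := loc _ (divr_gt0 r0 (ltr0n _ 2)).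
rewrite /P => Pt; suff : normc (oint f a b t) <= eta * m a b t by rewrite leNgt Pt.
rewrite -(affine (f (u +i* v)) d (u +i* v) a b t (ltW t0)).
apply: le_trans (oint_bound (M := eta / 16 * (2 * t)) (ltW t0)
  (cfa _ _ _ _ _ _) _) _.
  move=> w _ wQ; rewrite opprD addrA.
  have wd := dist _ _ _ _ ha hb wQ.
  apply: le_trans (Hr _ _) _; first by apply: le_lt_trans wd _; lra.
  by rewrite ler_pM2l.
rewrite (_ : 8 * _ * t = eta * (t * t)); last by field.
by rewrite ler_pM2l // /m lerDl mulr_ge0 // G0 // ltW.
Qed.

End Goursat.

(** * Cauchy's formula *)

#[local] Opaque oint.

Section CauchyTransform.
Variables (R : realType) (r : R).
Hypothesis r0 : 0 < r.
Local Notation C := (CC R).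
Implicit Types (f phi : C -> C) (z w v : C).

Definition centered_frame w := frame (- r) (- r) (r + r) w.
Definition centered_int f := oint f (- r) (- r) (r + r).
Definition frame_cont f := frame_continuous f (- r) (- r) (r + r).

Let r20 : 0 <= r + r. Proof. by rewrite addr_ge0 // ltW. Qed.

(** The four lines are at distance r from 0, even when prolonged beyond the square. Hence the
    kernels 1/(w - z) have no pole on the frame when |z| < r. *)
Lemma frame_normc w : centered_frame w -> r <= normc w.
Proof.
have rr : - r + (r + r) = r by rewrite addKr.
case; rewrite ?rr => h.
- by apply: le_trans (Re_le_normc _); rewrite h normrN ger0_norm // ltW.
- by apply: le_trans (Re_le_normc _); rewrite h ger0_norm // ltW.
- by apply: le_trans (Im_le_normc _); rewrite h normrN ger0_norm // ltW.
- by apply: le_trans (Im_le_normc _); rewrite h ger0_norm // ltW.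
Qed.

Lemma frame_dist w z : centered_frame w -> r - normc z <= normc (w - z).
Proof.
move=> /frame_normc rw; have := ler_normcD (w - z) z; rewrite subrK.
by move: rw; lra.
Qed.

Lemma frame_sub_neq0 z w : normc z < r -> centered_frame w -> w - z != 0.
Proof.
move=> zr /(frame_dist z) h; rewrite -normc_gt0; apply: lt_le_trans h.
by rewrite subr_gt0.
Qed.

Lemma frame_neq0 w : centered_frame w -> w != 0.
Proof. by move=> /frame_normc h; rewrite -normc_gt0 (lt_le_trans r0). Qed.

Lemma frame_cont_cst (c : C) : frame_cont (fun=> c).
Proof. by move=> w _; exact: cst_continuous. Qed.

Lemma frame_contD f g : frame_cont f -> frame_cont g ->
  frame_cont (fun w => f w + g w).
Proof. by move=> cf cg w h; apply: continuousD; [exact: cf|exact: cg]. Qed.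

Lemma frame_contM f g : frame_cont f -> frame_cont g ->
  frame_cont (fun w => f w * g w).
Proof. by move=> cf cg w h; apply: continuousM; [exact: cf|exact: cg]. Qed.

Lemma frame_contZ (k : C) f : frame_cont f -> frame_cont (fun w => k * f w).
Proof. by move=> cf; exact: (frame_contM (@frame_cont_cst k) cf). Qed.

Lemma frame_cont_der f : (forall w, centered_frame w -> exists d, is_derive w 1 f d) ->
  frame_cont f.
Proof. by move=> df w /df[d dfw]; exact: (der_continuous dfw). Qed.

Lemma frame_cont_kernel z n : normc z < r -> frame_cont (fun w => (w - z) ^- n.+1).
Proof.
move=> zr; apply: frame_cont_der => w /(frame_sub_neq0 zr) wz; eexists.
apply: derV (derX n (derB (der_id w) (der_cst z w))).
by rewrite expf_neq0.
Qed.

Lemma frame_cont_inv z : normc z < r -> frame_cont (fun w => (w - z)^-1).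
Proof. by move=> zr w; exact: (@frame_cont_kernel z 0). Qed.

Lemma continuous_segment_bounded (h : R -> R) (a b : R) : a <= b -> continuous h ->
  exists M, forall t, a <= t <= b -> `|h t| <= M.
Proof.
move=> ab ch.
have [c _ hc] := EVT_max ab (continuous_subspaceT ch).
have [d _ hd] := EVT_min ab (continuous_subspaceT ch).
exists (`|h c| + `|h d|) => t tab.
have {}hc : h t <= h c by apply: hc; rewrite in_itv.
have {}hd : h d <= h t by apply: hd; rewrite in_itv.
have := ler_norm (h c); have := ler_norm (- h d); rewrite normrN => h1 h2.
have := normr_ge0 (h c); have := normr_ge0 (h d).
by rewrite ler_norml => h3 h4; apply/andP; split; lra.
Qed.

(** The lines are unbounded, so the bound is restricted to the four compact sides, each handled by
    the extreme value theorem on real and imaginary parts. *)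
Lemma frame_bounded f : frame_cont f ->
  exists2 M, 0 < M & forall w, centered_frame w ->
    in_square (- r) (- r) (r + r) w -> normc (f w) <= M.
Proof.
move=> cf.
have key (l : R -> C) : (forall t t', normc (l t - l t') <= `|t - t'|) ->
    (forall t, centered_frame (l t)) ->
    exists M, forall t, - r <= t <= - r + (r + r) -> normc (f (l t)) <= M.
  move=> lip fr.
  have hr : - r <= - r + (r + r) by rewrite lerDl.
  have [M1 H1] := continuous_segment_bounded hr
    (fun t => (@line_continuous R f l t lip (cf _ (fr t))).1).
  have [M2 H2] := continuous_segment_bounded hr
    (fun t => (@line_continuous R f l t lip (cf _ (fr t))).2).
  exists (M1 + M2) => t ht; apply: le_trans (normc_leD _) _.
  by rewrite lerD // ?H1 ?H2.
have hlip y t t' : normc (horizontal_line y t - horizontal_line y t' : C) <= `|t - t'|.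
  by rewrite /= subrr [0 ^+ _]expr0n addr0 sqrtr_sqr.
have vlip x t t' : normc (vertical_line x t - vertical_line x t' : C) <= `|t - t'|.
  by rewrite /= subrr [0 ^+ _]expr0n add0r sqrtr_sqr.
have [t|M1 H1] := key _ (vlip (- r)); first exact: Or41.
have [t|M2 H2] := key _ (vlip (- r + (r + r))); first exact: Or42.
have [t|M3 H3] := key _ (hlip (- r)); first exact: Or43.
have [t|M4 H4] := key _ (hlip (- r + (r + r))); first exact: Or44.
exists (`|M1| + `|M2| + `|M3| + `|M4| + 1) => [|[a b] fw /andP[/= ha hb]].
  have := normr_ge0 M1; have := normr_ge0 M2; have := normr_ge0 M3.
  by have := normr_ge0 M4; lra.
have := ler_norm M1; have := ler_norm M2; have := ler_norm M3; have := ler_norm M4.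
have := normr_ge0 M1; have := normr_ge0 M2; have := normr_ge0 M3; have := normr_ge0 M4.
case: fw => /= E; [have := H1 _ hb|have := H2 _ hb|have := H3 _ ha|have := H4 _ ha];
  rewrite /vertical_line /horizontal_line -E /=; lra.
Qed.

Lemma centered_int_bound f M : frame_cont f ->
  (forall w, centered_frame w -> in_square (- r) (- r) (r + r) w -> normc (f w) <= M) ->
  normc (centered_int f) <= 16 * r * M.
Proof.
move=> cf fM; apply: le_trans (oint_bound r20 cf fM) _.
by rewrite le_eqVlt; apply/orP; left; apply/eqP; ring.
Qed.

Lemma centered_intD f g : frame_cont f -> frame_cont g ->
  centered_int (fun w => f w + g w) = centered_int f + centered_int g.
Proof. exact: ointD. Qed.

Lemma centered_intZ (k : C) f : frame_cont f ->
  centered_int (fun w => k * f w) = k * centered_int f.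
Proof. exact: ointZ. Qed.

Lemma eq_centered_int f g : (forall w, centered_frame w -> f w = g w) ->
  centered_int f = centered_int g.
Proof. by move=> fg; apply: eq_oint => // w fw _; exact: fg. Qed.

(** Differentiation under the integral sign. The second-order remainder is supplied exactly, as (w -
    z)^2 times a bounded [B], so linearity and the length bound suffice and no interchange of limits
    is needed. *)
Lemma param_int_derive (A : C -> C -> C) (A' : C -> C) (B : C -> C -> C)
    (z : C) (d M : R) :
  0 < d -> frame_cont A' ->
  (forall w, normc (w - z) < d -> frame_cont (A w) /\ frame_cont (B w)) ->
  (forall w v, normc (w - z) < d -> centered_frame v ->
     A w v - A z v - (w - z) * A' v = (w - z) ^+ 2 * B w v) ->
  (forall w v, normc (w - z) < d -> centered_frame v ->
     in_square (- r) (- r) (r + r) v -> normc (B w v) <= M) ->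
  is_derive z 1 (fun w => centered_int (A w)) (centered_int A').
Proof.
move=> d0 cA' cAB AB BM; apply/is_deriveCP => e e0.
have zd : normc (z - z) < d by rewrite subrr normc0.
(* The remainder of the integral is at most 16 r |M| |w - z|^2; the absolute value and the added 1
   ensure that [K] is positive. *)
pose K := 16 * r * `|M| + 1.
have K0 : 0 < K by rewrite ltr_wpDl // !mulr_ge0 // ltW.
exists (Num.min d (e / K)) => [|w]; first by rewrite lt_min d0 divr_gt0.
rewrite lt_min => /andP[wd we].
have [cA cB] := cAB _ wd; have [cAz _] := cAB _ zd.
have -> : centered_int (A w) - centered_int (A z) - centered_int A' * (w - z) =
    (w - z) ^+ 2 * centered_int (B w).
  rewrite -centered_intZ //.
  rewrite -(eq_centered_int (fun v => AB w v wd)).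
  have -> : centered_int (fun v => A w v - A z v - (w - z) * A' v) =
      centered_int (fun v => A w v + (-1) * A z v + (- (w - z)) * A' v).
    by apply: eq_centered_int => v _; ring.
  rewrite (centered_intD (frame_contD cA (@frame_contZ _ _ cAz)) (@frame_contZ _ _ cA')).
  rewrite (centered_intD cA (@frame_contZ _ _ cAz)) (centered_intZ _ cAz)
    (centered_intZ _ cA').
  by move: (centered_int _) (centered_int _) (centered_int _) => a b c; ring.
rewrite normcMC normcXC expr2 -mulrA mulrC ler_wpM2r ?normc_ge0 //.
apply: le_trans (ler_wpM2l (normc_ge0 _) (centered_int_bound (M := `|M|) cB _)) _.
  by move=> v fv sv; apply: le_trans (BM _ _ wd fv sv) _; exact: ler_norm.
move: we; rewrite ltr_pdivlMr // => /ltW; apply: le_trans.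
by rewrite ler_wpM2l ?normc_ge0 // /K lerDl.
Qed.

(** * The Cauchy transform and its first two derivatives *)

Definition cauchy_transform phi z := centered_int (fun w => phi w / (w - z)).

Lemma frame_cont_cauchy phi z : frame_cont phi -> normc z < r ->
  frame_cont (fun w => phi w / (w - z)).
Proof. by move=> cphi zr; exact: frame_contM cphi (frame_cont_inv zr). Qed.

Lemma cauchy_transform_derive phi z : frame_cont phi -> normc z < r ->
  is_derive z 1 (cauchy_transform phi) (centered_int (fun w => phi w * (w - z) ^- 2)).
Proof.
move=> cphi zr; have [M M0 HM] := frame_bounded cphi.
(* Half of a lower bound for the distance from z to the frame: moving z by less than d leaves at
   least d. *)
pose d := (r - normc z) / 2.
have d0 : 0 < d by rewrite divr_gt0 // subr_gt0.
have wr w : normc (w - z) < d -> normc w < r.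
  by move=> wd; have := ler_normcD (w - z) z; rewrite subrK; move: wd; rewrite /d; lra.
have dist v w : normc (w - z) < d -> centered_frame v -> d <= normc (v - w).
  move=> wd fv; have := frame_dist z fv; have := ler_normcD (v - w) (w - z).
  by rewrite addrA subrK; move: wd; rewrite /d; lra.
(* With a = v - z and b = v - w, the remainder is 1/b - 1/a - (w - z)/a^2 = (w - z)^2 / (b a^2). *)
apply: (@param_int_derive (fun z v => phi v / (v - z)) _
  (fun w v => phi v * ((v - w)^-1 * (v - z) ^- 2)) z d (M * (d^-1 * (d ^+ 2)^-1)) d0).
- exact: frame_contM cphi (@frame_cont_kernel _ 1 zr).
- move=> w /wr wr'; split; first exact: frame_cont_cauchy.
  exact: frame_contM cphi (frame_contM (frame_cont_inv wr') (@frame_cont_kernel _ 1 zr)).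
- move=> w v /wr wr' fv.
  have h1 := frame_sub_neq0 wr' fv; have h2 := frame_sub_neq0 zr fv.
  by field; rewrite ?h1 ?h2.
- move=> w v wd fv sv; rewrite !normcMC !normcVC normcXC.
  have zd : normc (z - z) < d by rewrite subrr normc0.
  have dv := dist _ _ wd fv; have dz := dist _ _ zd fv.
  rewrite ler_pM ?mulr_ge0 ?invr_ge0 ?exprn_ge0 ?normc_ge0 ?HM //.
  by rewrite ler_pM ?invr_ge0 ?exprn_ge0 ?normc_ge0 // lef_pV2 ?posrE ?exprn_gt0 //
    ?(lt_le_trans d0) // ler_pXn2r // nnegrE ?normc_ge0 // ltW.
Qed.

(** With a = v - z and b = v - w, one has 1/b^2 - 1/a^2 - 2(w - z)/a^3 = (w - z)^2 (1/(a^2 b^2) +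
    2/(a^3 b)). Existence is enough to see that derivatives of holomorphic germs are holomorphic. *)
Lemma cauchy_transform_derive2 phi z : frame_cont phi -> normc z < r ->
  exists l, is_derive z 1 (fun z => centered_int (fun w => phi w * (w - z) ^- 2)) l.
Proof.
move=> cphi zr; have [M M0 HM] := frame_bounded cphi.
pose d := (r - normc z) / 2.
have d0 : 0 < d by rewrite divr_gt0 // subr_gt0.
have wr w : normc (w - z) < d -> normc w < r.
  by move=> wd; have := ler_normcD (w - z) z; rewrite subrK; move: wd; rewrite /d; lra.
have dist v w : normc (w - z) < d -> centered_frame v -> d <= normc (v - w).
  move=> wd fv; have := frame_dist z fv; have := ler_normcD (v - w) (w - z).
  by rewrite addrA subrK; move: wd; rewrite /d; lra.
exists (centered_int (fun w => phi w * (2 * (w - z) ^- 3))).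
apply: (@param_int_derive (fun z v => phi v * (v - z) ^- 2) _
  (fun w v => phi v * ((v - w) ^- 2 * (v - z) ^- 2) +
     2 * (phi v * ((v - w) ^- 1 * (v - z) ^- 3))) z d
  (M * ((d ^+ 2)^-1 * (d ^+ 2)^-1) + 2 * (M * ((d ^+ 1)^-1 * (d ^+ 3)^-1))) d0).
- exact: frame_contM cphi (@frame_contZ 2 _ (@frame_cont_kernel _ 2 zr)).
- move=> w /wr wr'; split; first exact: frame_contM cphi (@frame_cont_kernel _ 1 wr').
  have bk n k := frame_contM cphi (frame_contM
    (@frame_cont_kernel _ n wr') (@frame_cont_kernel _ k zr)).
  exact: frame_contD (bk 1 1) (@frame_contZ 2 _ (bk 0 2)).
- move=> w v /wr wr' fv.
  have h1 := frame_sub_neq0 wr' fv; have h2 := frame_sub_neq0 zr fv.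
  by field; rewrite ?h1 ?h2.
- move=> w v wd fv sv.
  have zd : normc (z - z) < d by rewrite subrr normc0.
  have dv := dist _ _ wd fv; have dz := dist _ _ zd fv.
  have bnd n k : normc (phi v * ((v - w) ^- n * (v - z) ^- k)) <=
      M * ((d ^+ n)^-1 * (d ^+ k)^-1).
    rewrite !normcMC !normcVC !normcXC.
    rewrite ler_pM ?mulr_ge0 ?invr_ge0 ?exprn_ge0 ?normc_ge0 ?HM //.
    by rewrite ler_pM ?invr_ge0 ?exprn_ge0 ?normc_ge0 // lef_pV2 ?posrE ?exprn_gt0 //
      ?(lt_le_trans d0) // lerXn2r // nnegrE ?normc_ge0 // ltW.
  apply: le_trans (ler_normcD _ _) _; rewrite lerD //.
  by rewrite !mulr_natl !mulr2n; apply: le_trans (ler_normcD _ _) _; rewrite lerD.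
Qed.

(** * Cauchy's formula and Taylor remainders *)

Local Notation T := cauchy_transform.

Lemma continuous_near f g z : (\forall w \near z, f w = g w) ->
  {for z, continuous f} -> {for z, continuous g}.
Proof.
move=> /nearCP[d d0 fg] /continuousCP cf; apply/continuousCP => e /cf[d' d'0 H].
exists (Num.min d d') => [|w]; first by rewrite lt_min d0.
rewrite lt_min => /andP[wd wd']; rewrite -fg // -fg ?subrr ?normc0 //; exact: H.
Qed.

Lemma near_neq z w : w != z -> \forall v \near w, v != z.
Proof.
move=> wz; apply/nearCP; exists (normc (z - w)).
  by rewrite normc_gt0 subr_eq0 eq_sym.
by move=> v; apply: contraTneq => ->; rewrite ltxx.
Qed.

(** The difference quotient, completed by the derivative at z, is continuous, so [goursat_square]
    makes its integral vanish; on the frame it splits into the two transforms. The factor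
    [T (fun=> 1) z] is classically 2 pi i. *)
Lemma cauchy_formula f z : continuous f ->
  (forall w, in_square (- r) (- r) (r + r) w -> derivable f w 1) ->
  normc z < r -> f z * T (fun=> 1) z = T f z.
Proof.
move=> cf df zr.
have zQ : in_square (- r) (- r) (r + r) z.
  have := le_lt_trans (Re_le_normc z) zr; have := le_lt_trans (Im_le_normc z) zr.
  by rewrite !ltr_norml /in_square addKr => /andP[/ltW -> /ltW ->] /andP[/ltW -> /ltW ->].
have /derivableP dfz := df z zQ.
pose q w := if w == z then 'D_1 f z else (f w - f z) / (w - z).
have qE w : w != z -> q w = (f w - f z) / (w - z) by rewrite /q => /negPf ->.
have qz : q z = 'D_1 f z by rewrite /q eqxx.
have qnear w : w != z -> \forall v \near w, (f v - f z) / (v - z) = q v.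
  by move=> wz; apply: filterS (near_neq wz) => v /qE.
have cq : continuous q.
  move=> w; have [->|wz] := eqVneq w z.
    apply/continuousCP => e e0.
    have e20 : 0 < e / 2 by rewrite divr_gt0.
    have /is_deriveCP /(_ _ e20) [d d0 H] := dfz.
    exists d => // v /H; have [->|vz] := eqVneq v z.
      by move=> _; rewrite subrr normc0.
    have vz0 : v - z != 0 by rewrite subr_eq0.
    rewrite qE // qz => h.
    have -> : (f v - f z) / (v - z) - 'D_1 f z =
        (f v - f z - 'D_1 f z * (v - z)) / (v - z) by field.
    rewrite normcMC normcVC ltr_pdivrMr ?normc_gt0 //.
    by apply: le_lt_trans h _; rewrite ltr_pM2r ?normc_gt0 //; lra.
  apply: continuous_near (qnear w wz) _.
  apply: continuousM; last first.
    apply: (der_continuous (@derV _ (fun v => v - z) w _ _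
      (derB (der_id w) (der_cst z w)))).
    by rewrite subr_eq0.
  by apply: continuousB; [exact: cf|exact: cst_continuous].
have dq w : in_square (- r) (- r) (r + r) w -> w != z -> derivable q w 1.
  move=> wQ wz; have /derivableP dfw := df w wQ.
  have wz0 : w - z != 0 by rewrite subr_eq0.
  have dw := derM (derB dfw (der_cst (f z) w)) 
    (@derV _ (fun v => v - z) w _ wz0 (derB (der_id w) (der_cst z w))).
  by have [] := near_eq_is_derive (qnear w wz) dw.
have /= := goursat_square (addr_gt0 r0 r0) cq dq.
rewrite -/(centered_int q).
have cfr : frame_cont f by move=> w _; exact: cf.
have -> : centered_int q =
    centered_int (fun w => f w / (w - z) + (- f z) * (1 / (w - z))).
  apply: eq_centered_int => // w fw; have wz := frame_sub_neq0 zr fw.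
  by rewrite qE ?mulrBl ?div1r ?mulNr // -subr_eq0.
have c1 := frame_cont_cauchy (@frame_cont_cst 1) zr.
rewrite (centered_intD (frame_cont_cauchy cfr zr) (@frame_contZ _ _ c1)).
rewrite (centered_intZ _ c1) mulNr => /eqP; rewrite subr_eq0 => /eqP <-.
by [].
Qed.

(** Integrate 1/(w - z) = 1/w + z/(w(w - z)) against [phi]. *)
Lemma cauchy_transform0 phi z : frame_cont phi -> normc z < r ->
  T phi z = T phi 0 + z * T (fun w => phi w / w) z.
Proof.
move=> cphi zr.
have z0r : normc (0 : C) < r by rewrite normc0.
have cw : frame_cont (fun w => phi w / w).
  have -> : (fun w => phi w / w) = fun w => phi w / (w - 0).
    by apply/funext => w; rewrite subr0.
  exact: frame_cont_cauchy.
rewrite -(centered_intZ _ (frame_cont_cauchy cw zr)).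
rewrite -(centered_intD (frame_cont_cauchy cphi z0r)
  (@frame_contZ _ _ (frame_cont_cauchy cw zr))).
apply: eq_centered_int => // w fw.
have := frame_sub_neq0 zr fw; have := frame_neq0 fw => h1 h2.
by rewrite subr0; field; rewrite ?h1 ?h2.
Qed.

(** Up to the factor 2 pi i, [T (shifted phi n) 0] is the n-th Taylor coefficient of the transform
    of [phi], and [T (shifted phi n) z] is its remainder from order n on, divided by z^n. *)
Definition shifted phi n w := phi w / w ^+ n.

Lemma frame_cont_shifted phi n : frame_cont phi -> frame_cont (shifted phi n).
Proof.
move=> cphi; have -> : shifted phi n = fun w => phi w * (w - 0) ^- n.
  by apply/funext => w; rewrite subr0.
apply: (frame_contM cphi); case: n => [|n].
  have -> : (fun v : C => (v - 0) ^- 0) = fun=> 1.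
    by apply/funext => v; rewrite expr0 invr1.
  exact: frame_cont_cst.
by apply: (@frame_cont_kernel 0 n); rewrite normc0.
Qed.

Lemma cauchy_transform_shifted phi n z : frame_cont phi -> normc z < r ->
  T (shifted phi n) z = T (shifted phi n) 0 + z * T (shifted phi n.+1) z.
Proof.
move=> cphi zr; rewrite (cauchy_transform0 (@frame_cont_shifted _ n cphi) zr).
congr (_ + _ * _); apply: eq_centered_int => // w fw.
by rewrite /shifted exprSr invfM mulrA.
Qed.

(** On the frame |w - z| >= r/2, and 16 r times 2/r is 32. *)
Lemma cauchy_transform_bound phi z M : frame_cont phi ->
  (forall w, centered_frame w -> in_square (- r) (- r) (r + r) w -> normc (phi w) <= M) ->
  normc z <= r / 2 -> normc (T phi z) <= 32 * M.
Proof.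
move=> cphi phiM zr2.
have zr : normc z < r by move: r0; lra.
apply: le_trans (centered_int_bound (M := M * (r / 2)^-1) (frame_cont_cauchy cphi zr) _) _.
  move=> w fw sw; rewrite normcMC normcVC.
  rewrite ler_pM ?invr_ge0 ?normc_ge0 ?phiM // lef_pV2 ?posrE ?divr_gt0 //.
    by apply: le_trans (frame_dist z fw); lra.
  by rewrite normc_gt0; exact: frame_sub_neq0 zr fw.
rewrite le_eqVlt; apply/orP; left; apply/eqP; field.
exact: lt0r_neq0.
Qed.

(** If all coefficients vanish, the transform equals z^n times its n-th remainder. As |w| >= r on
    the frame, it is at most (r/2)^n 32 M / r^n = 32 M / 2^n for every n. *)
Lemma cauchy_transform_eq0 phi z : frame_cont phi ->
  (forall n, T (shifted phi n) 0 = 0) -> normc z <= r / 2 -> T phi z = 0.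
Proof.
move=> cphi phi0 zr2.
have zr : normc z < r by move: r0; lra.
have TE n : T phi z = z ^+ n * T (shifted phi n) z.
  elim: n => [|n IH].
    by rewrite mul1r; apply: eq_centered_int => // w _; rewrite /shifted divr1.
  by rewrite IH cauchy_transform_shifted // phi0 add0r mulrA exprSr.
have [M M0 HM] := frame_bounded cphi.
have Tn n : normc (T phi z) <= 32 * M / 2 ^+ n.
  rewrite (TE n) normcMC normcXC.
  apply: le_trans (_ : (r / 2) ^+ n * (32 * (M / r ^+ n)) <= _).
    rewrite ler_pM ?normc_ge0 ?exprn_ge0 ?normc_ge0 //.
      by rewrite lerXn2r // nnegrE ?normc_ge0 // divr_ge0 // ltW.
    apply: (cauchy_transform_bound (@frame_cont_shifted _ n cphi) _ zr2).
    move=> w fw sw; rewrite normcMC normcVC normcXC.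
    rewrite ler_pM ?normc_ge0 ?invr_ge0 ?exprn_ge0 ?normc_ge0 ?HM //.
    have rw := frame_normc fw.
    rewrite lef_pV2 ?posrE ?exprn_gt0 // ?(lt_le_trans r0) //.
    by rewrite lerXn2r // nnegrE ?normc_ge0 // ltW.
  rewrite expr_div_n le_eqVlt; apply/orP; left; apply/eqP; field.
  by rewrite !expf_neq0 //; exact: lt0r_neq0.
apply/eqP; rewrite -normc_eq0C eq_le normc_ge0 andbT leNgt; apply/negP => Tp.
pose n := (Num.trunc (32 * M / normc (T phi z))).+1.
have := Tn n; rewrite leNgt => /negP[].
rewrite ltr_pdivrMr ?exprn_gt0 // [X in _ < X]mulrC -ltr_pdivrMr //.
apply: lt_le_trans (truncnS_gt _) _.
by rewrite -natrX ler_nat ltnW // ltn_expl.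
Qed.

Lemma cauchy_transform_cst z : normc z <= r / 2 -> T (fun=> 1) z = T (fun=> 1) 0.
Proof.
move=> zr2.
have zr : normc z < r by move: r0; lra.
have c1 := @frame_cont_cst 1.
rewrite (cauchy_transform0 c1 zr) (_ : T (fun w => 1 / w) z = 0) ?mulr0 ?addr0 //.
have cw : frame_cont (fun w => 1 / w).
  by have := @frame_cont_shifted (fun=> 1) 1 c1.
apply: (cauchy_transform_eq0 cw _ zr2) => n.
(* The coefficients of the transform of 1/w are integrals of w^-(n+2), which has an antiderivative
   away from 0. *)
apply: (oint_deriv (F := fun w => - (n.+1%:R)^-1 * (w ^+ n.+1)^-1)).
  by rewrite addr_ge0 // ltW.
move=> w fw; have w0 := frame_neq0 fw.
have wn : w ^+ n.+1 != 0 by rewrite expf_neq0.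
apply: der_eq (derZ (- (n.+1%:R)^-1) 
  (@derV _ (fun v => v ^+ n.+1) w _ wn (derX n (der_id w)))) _.
rewrite /shifted subr0 !exprS; field.
by rewrite w0 expf_neq0 // nat1r pnatr_eq0.
Qed.

(** On each side the relevant component of 1/w is at least 1/(2r) in absolute value, with the sign
    of the orientation. A side of length 2r therefore adds at least 1 to the imaginary part. *)
Lemma winding_neq0 : T (fun=> 1) 0 != 0.
Proof.
suff : 0 < complex.Im (T (fun=> 1) 0).
  by apply: contraTneq => ->; rewrite ltxx.
have rr : - r + (r + r) = r by rewrite addKr.
have z0r : normc (0 : C) < r by rewrite normc0.
have c1 := frame_cont_cauchy (@frame_cont_cst 1) z0r.
have [p1 p2 p3 p4] := @frame_primable R _ _ _ _ (- r) r c1.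
have rle : - r <= r by move: r0; lra.
rewrite /cauchy_transform /centered_int ointE.
rewrite ![- r + (r + r)]addKr in p2 p4 *.
pose k (w : C) := 1 / (w - 0).
have kE (a b : R) : 1 / ((a +i* b : C) - 0) =
    (a / (a ^+ 2 + b ^+ 2)) +i* (- (b / (a ^+ 2 + b ^+ 2))).
  by rewrite subr0 div1r.
have bound t : - r <= t <= r -> (2 * r)^-1 <= r / (t ^+ 2 + r ^+ 2).
  move=> /andP[t1 t2].
  have tr : t ^+ 2 <= r ^+ 2.
    by rewrite -[t ^+ 2]real_normK ?num_real // lerXn2r ?nnegrE ?(ltW r0) // ler_norml t1.
  have r2 : 0 < r ^+ 2 by rewrite exprn_gt0.
  rewrite ler_pdivlMr ?ltr_wpDl ?sqr_ge0 // mulrC ler_pdivrMr ?mulr_gt0 //.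
  by move: tr; rewrite expr2 => tr; lra.
have mr : (2 * r)^-1 * (r - - r) = 1 by field; exact: lt0r_neq0.
have A1 : 1 <= complex.Im (cint (k \o horizontal_line (- r)) (- r) r).
  rewrite -mr; apply: cint_Im_ge => // t tr.
  by rewrite /comp /horizontal_line /k kE /= mulNr opprK sqrrN bound.
have A2 : complex.Im (cint (k \o horizontal_line r) (- r) r) <= - 1.
  rewrite -mr -mulNr; apply: cint_Im_le => // t tr.
  by rewrite /comp /horizontal_line /k kE /= lerN2 bound.
have A3 : complex.Re (cint (k \o vertical_line (- r)) (- r) r) <= - 1.
  rewrite -mr -mulNr; apply: cint_Re_le => // t tr.
  by rewrite /comp /vertical_line /k kE /= mulNr lerN2 sqrrN addrC bound.
have A4 : 1 <= complex.Re (cint (k \o vertical_line r) (- r) r).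
  rewrite -mr; apply: cint_Re_ge => // t tr.
  by rewrite /comp /vertical_line /k kE /= addrC bound.
rewrite -/k; move: A1 A2 A3 A4.
move: (cint _ _ _) (cint _ _ _) (cint _ _ _) (cint _ _ _).
by move=> [a1 a2] [b1 b2] [d1 d2] [e1 e2] /=; lra.
Qed.

End CauchyTransform.

(** * Germs of holomorphic functions *)

Section Germs.
Variable R : realType.
Local Notation C := (CC R).
Implicit Types (f g u : C -> C) (z w : C).

Lemma near_ball (rho : R) (P : C -> Prop) z :
  (forall w, normc w < rho -> P w) -> normc z < rho -> \forall w \near z, P w.
Proof.
move=> HP zr; apply/nearCP; exists (rho - normc z); first by rewrite subr_gt0.
move=> w wz; apply: HP; have := ler_normcD (w - z) z; rewrite subrK.
by move: wz; lra.
Qed.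

Lemma near0P (P : C -> Prop) : (\forall w \near (0 : C), P w) <->
  exists2 rho : R, 0 < rho & forall w, normc w < rho -> P w.
Proof.
split=> [/nearCP[d d0 H]|[d d0 H]].
  by exists d => // w wd; apply: H; rewrite subr0.
by apply: (near_ball H); rewrite normc0.
Qed.

Lemma near_near0 (P : C -> Prop) : (\forall w \near (0 : C), P w) ->
  \forall z \near (0 : C), \forall w \near z, P w.
Proof.
move=> /near0P[rho rho0 H]; apply/near0P; exists rho => // z zr.
exact: near_ball H zr.
Qed.

(** Applied to both coordinates, this is a Lipschitz retraction of the plane onto a square; it turns
    a germ into a function continuous everywhere. *)
Let clamp (s x : R) := Num.max (- s) (Num.min s x).

Let clamp_lip s x y : `|clamp s x - clamp s y| <= `|x - y|.
Proof.
have key a b : a <= b -> clamp s a <= clamp s b <= clamp s a + (b - a).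
  move=> ab; rewrite /clamp !minEle; do ![case: ifPn; rewrite -?ltNge => ?];
    rewrite !maxEle; do ![case: ifPn; rewrite -?ltNge => ?];
    by apply/andP; split; lra.
case: (leP x y) => [/key|/ltW/key] /andP[h1 h2].
  by rewrite distrC [X in _ <= X]distrC !ger0_norm ?subr_ge0 //; lra.
by rewrite !ger0_norm ?subr_ge0 //; lra.
Qed.

Let clamp_bound s x : 0 <= s -> `|clamp s x| <= s.
Proof.
move=> s0; rewrite /clamp minEle ler_norml; case: ifPn; rewrite -?ltNge => ?;
  rewrite maxEle; case: ifPn; rewrite -?ltNge => ?;
  by apply/andP; split; lra.
Qed.

Let clamp_id s x : `|x| <= s -> clamp s x = x.
Proof.
rewrite ler_norml => /andP[h1 h2]; rewrite /clamp minEle.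
by case: ifPn; rewrite -?ltNge => ?; rewrite maxEle; case: ifPn; rewrite -?ltNge => ?; lra.
Qed.

Lemma continuous_extension f : holo_near0 f -> exists (r : R) (F : C -> C),
  [/\ 0 < r, continuous F,
      forall w, in_square (- r) (- r) (r + r) w -> derivable F w 1 &
      forall w, normc w < r -> F w = f w].
Proof.
move=> /near0P[d d0 df].
(* Clamping at 2r keeps norms at most 4r = d/2, inside the domain of [f], and is the identity near
   the closed square of half-side r, so derivatives there are unchanged. *)
pose r := d / 8; have r0 : 0 < r by rewrite divr_gt0.
pose c (w : C) : C := clamp (2 * r) (complex.Re w) +i* clamp (2 * r) (complex.Im w).
have cd w : normc (c w) < d.
  have r2 : 0 <= 2 * r by rewrite mulr_ge0 // ltW.
  apply: le_lt_trans (normc_leD _) _.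
  have := clamp_bound (complex.Re w) r2; have := clamp_bound (complex.Im w) r2.
  by rewrite /c /=; move: r0; rewrite /r; lra.
have clip w z : normc (c w - c z) <= 2 * normc (w - z).
  apply: le_trans (normc_leD _) _.
  have h1 := Re_le_normc (w - z); have h2 := Im_le_normc (w - z).
  rewrite ReB in h1; rewrite ImB in h2; rewrite ReB ImB.
  have := clamp_lip (2 * r) (complex.Re w) (complex.Re z).
  have := clamp_lip (2 * r) (complex.Im w) (complex.Im z).
  by move: h1 h2; rewrite /c /=; lra.
have cid w : `|complex.Re w| < 2 * r -> `|complex.Im w| < 2 * r -> c w = w.
  by case: w => a b /= h1 h2; rewrite /c /= !clamp_id // ltW.
exists r, (f \o c); split=> //.
- move=> z; apply/continuousCP => e e0.
  have /derivableP dfz := df _ (cd z).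
  have /continuousCP /(_ e e0)[d' d'0 H] := der_continuous dfz.
  exists (d' / 2) => [|w wz /=]; first by rewrite divr_gt0.
  by apply: H; apply: le_lt_trans (clip _ _) _; lra.
- move=> w; rewrite /in_square addKr => /andP[/andP[h1 h2] /andP[h3 h4]].
  have wE : c w = w by apply: cid; rewrite ltr_norml; apply/andP; split; lra.
  have /derivableP dfz := df _ (cd w); rewrite wE in dfz.
  suff nr : \forall v \near w, f v = (f \o c) v by have [] := near_eq_is_derive nr dfz.
  apply/nearCP; exists r => // v vw /=; rewrite cid //.
    have := Re_le_normc (v - w); rewrite ReB ler_norml ltr_norml => /andP[h5 h6].
    by apply/andP; split; lra.
  have := Im_le_normc (v - w); rewrite ImB ler_norml ltr_norml => /andP[h5 h6].
  by apply/andP; split; lra.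
- move=> w wr /=; rewrite cid //.
    by apply: le_lt_trans (Re_le_normc _) _; lra.
  by apply: le_lt_trans (Im_le_normc _) _; lra.
Qed.

(** [W] is the winding integral at 0. The disc shrinks to r/2 because the winding integral is known
    to be constant only there. *)
Lemma cauchy_representation f : holo_near0 f -> exists (r : R) (F : C -> C) (W : C),
  [/\ 0 < r, continuous F, W != 0 &
      forall z, normc z < r / 2 -> f z = cauchy_transform r F z / W].
Proof.
move=> /continuous_extension[r [F [r0 cF dF Ff]]].
have W0 := winding_neq0 r0.
exists r, F, (cauchy_transform r (fun=> 1) 0); split=> // z zr2.
have zr : normc z < r by lra.
rewrite -(cauchy_formula r0 cF dF zr) (cauchy_transform_cst r0 (ltW zr2)).
by rewrite mulfK // Ff.
Qed.

Lemma frame_cont_continuous (r : R) (F : C -> C) : continuous F -> frame_cont r F.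
Proof. by move=> cF w _; exact: cF. Qed.

(** [E n] is the n-th Taylor remainder divided by z^n, and [E n 0] the n-th coefficient; the last
    clause is the identity theorem for germs. *)
Lemma local_expansion f : holo_near0 f -> exists (rho : R) (E : nat -> C -> C),
  [/\ 0 < rho, forall z, normc z < rho -> f z = E 0%N z,
      forall n z, normc z < rho -> E n z = E n 0 + z * E n.+1 z,
      forall n z, normc z < rho -> derivable (E n) z 1 &
      (forall n, E n 0 = 0) -> forall z, normc z < rho -> f z = 0].
Proof.
move=> /cauchy_representation[r [F [W [r0 cF W0 fE]]]].
have cFr := frame_cont_continuous (r := r) cF.
exists (r / 2), (fun n z => cauchy_transform r (shifted F n) z / W).
have lt z : normc z < r / 2 -> normc z < r by move: r0; lra.
split; first by rewrite divr_gt0.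
- move=> z /fE ->; congr (_ / _); apply: eq_centered_int => // w _.
  by rewrite /shifted expr0 divr1.
- move=> n z /lt zr; rewrite [in LHS](cauchy_transform_shifted r0 n cFr zr).
  by rewrite mulrDl mulrA.
- move=> n z /lt zr.
  have d1 := cauchy_transform_derive r0 (@frame_cont_shifted R r r0 F n cFr) zr.
  by have [] := derM d1 (der_cst W^-1 z).
- move=> E0 z zr; rewrite fE //.
  rewrite (cauchy_transform_eq0 r0 cFr _ (ltW zr)) ?mul0r // => n.
  by apply/eqP; have /eqP := E0 n; rewrite mulf_eq0 invr_eq0 (negPf W0) orbF.
Qed.

Lemma holo_derive1 f : holo_near0 f -> holo_near0 f^`().
Proof.
move=> /cauchy_representation[r [F [W [r0 cF W0 fE]]]].
have cFr := frame_cont_continuous (r := r) cF.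
have lt z : normc z < r / 2 -> normc z < r by move: r0; lra.
have r20 : 0 < r / 2 by rewrite divr_gt0.
pose D z := centered_int r (fun w => F w * (w - z) ^- 2) * W^-1.
have dE z : normc z < r / 2 -> D z = f^`() z.
  move=> zr; have d1 := cauchy_transform_derive r0 cFr (lt _ zr).
  have [_] := near_eq_is_derive (near_ball (fun w wr => esym (fE w wr)) zr)
    (derM d1 (der_cst W^-1 z)).
  by rewrite -derive1E => ->; rewrite mulr0 addr0.
apply/near0P; exists (r / 2) => // z zr.
have [l dl] := cauchy_transform_derive2 r0 cFr (lt _ zr).
by have [] := near_eq_is_derive (near_ball dE zr) (derM dl (der_cst W^-1 z)).
Qed.

End Germs.

(** * Order of vanishing, derivatives at 0 and composition of germs *)

Section GermCalculus.
Variable R : realType.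
Local Notation C := (CC R).
Implicit Types (f g u : C -> C) (z w : C).

Lemma holo_derivable0 f : holo_near0 f -> is_derive (0 : C) 1 f (derive1 f 0).
Proof. by move=> /nbhs_singleton /derivableP; rewrite derive1E. Qed.

Lemma holo_is_derive f : holo_near0 f ->
  \forall z \near (0 : C), is_derive (z : C) 1 f (derive1 f z).
Proof. by apply: filterS => z /derivableP; rewrite derive1E. Qed.

Lemma is_derive_derive1 f (z d : C) : is_derive z 1 f d -> derive1 f z = d.
Proof. by move=> [_ <-]; rewrite derive1E. Qed.

Lemma holo_continuous0 f : holo_near0 f -> {for 0, continuous f}.
Proof. by move=> /holo_derivable0 /der_continuous. Qed.

Lemma holoB_id f : holo_near0 f -> holo_near0 (fun z => f z - z).
Proof.
by apply: filterS => z /derivableP dz; have [] := derB dz (der_id z).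
Qed.

Lemma derive1_germ f g : germ_eq f g -> germ_eq (derive1 f) (derive1 g).
Proof.
move=> /near_near0; apply: filterS => z fg.
by rewrite !derive1E; exact: near_eq_derive.
Qed.

Lemma derive1n_germ n f g : germ_eq f g -> f^`(n) 0 = g^`(n) 0.
Proof.
elim: n f g => [|n IH] f g fg; first exact: nbhs_singleton fg.
by rewrite !derive1Sn; apply: IH; exact: derive1_germ.
Qed.

(** The exponent is the least index of a nonzero coefficient [E n 0], and the cofactor is the
    remainder [E n] itself. *)
Lemma holo_factor f : holo_near0 f ->
  germ_eq f (fun=> 0) \/
  exists n u, [/\ holo_near0 u, u 0 != 0 & germ_eq f (fun z => z ^+ n * u z)].
Proof.
move=> /local_expansion[rho [E [rho0 fE ES dE E0]]].
have [all0|/existsNP ex] := pselect (forall n, E n 0 = 0).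
  by left; apply/near0P; exists rho => // z; exact: E0.
right; have {}ex : exists n, E n 0 != 0 by case: ex => n /eqP; exists n.
case: (ex_minnP ex) => n En min_n; exists n, (E n); split => //.
  by apply/near0P; exists rho => // z; exact: dE.
apply/near0P; exists rho => // z zr; rewrite fE //.
have : forall k, (k <= n)%N -> E 0%N z = z ^+ k * E k z.
  elim=> [|k IH] kn; first by rewrite expr0 mul1r.
  rewrite IH ?(ltnW kn) // ES // (_ : E k 0 = 0) ?add0r ?exprSr ?mulrA //.
  by apply/eqP; apply: contraTT kn => /min_n; rewrite -leqNgt.
exact.
Qed.

Lemma holo_slope f : holo_near0 f ->
  exists u, holo_near0 u /\ \forall z \near (0 : C), f z = f 0 + z * u z.
Proof.
move=> /local_expansion[rho [E [rho0 fE ES dE E0]]].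
exists (E 1%N); split; first by apply/near0P; exists rho => // z; exact: dE.
by apply/near0P; exists rho => // z zr; rewrite !fE ?normc0 // -ES.
Qed.

Lemma derive1_factor n u : holo_near0 u ->
  exists2 v, holo_near0 v & v 0 = n.+1%:R * u 0 /\
    forall f, germ_eq f (fun z => z ^+ n.+1 * u z) ->
      germ_eq (derive1 f) (fun z => z ^+ n * v z).
Proof.
move=> hu; have hdu := holo_derive1 hu.
exists (fun z => n.+1%:R * u z + z * derive1 u z).
  have hu' := holo_is_derive hu; have hdu' := holo_is_derive hdu.
  apply: filterS2 hu' hdu' => z du ddu.
  by have [] := derD (derZ n.+1%:R du) (derM (der_id z) ddu).
split; first by rewrite mul0r addr0.
move=> f /derive1_germ; have hu' := holo_is_derive hu => hf.
apply: filterS2 hf hu' => z -> du.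
rewrite (is_derive_derive1 (derM (derX n (der_id z)) du)).
by rewrite exprS; ring.
Qed.

(** Links the iterated derivatives, in which [inGp] is phrased, to the order of vanishing. Each
    derivative lowers the exponent n by one and multiplies the value of the cofactor at 0 by n,
    whence the factorial. *)
Lemma derive1n_factor n u f : holo_near0 u ->
  germ_eq f (fun z => z ^+ n * u z) ->
  (forall k, (k < n)%N -> f^`(k) 0 = 0) /\ f^`(n) 0 = n`!%:R * u 0.
Proof.
elim: n u f => [|n IH] u f hu fE.
  by split => //; rewrite derive1n0 (nbhs_singleton fE) expr0.
have [v hv [v0 /(_ f fE) f'E]] := derive1_factor n hu.
have [lo hi] := IH v _ hv f'E; split.
  move=> [|k] kn; first by rewrite derive1n0 (nbhs_singleton fE) exprS !mul0r.
  by rewrite derive1Sn lo.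
by rewrite derive1Sn hi v0 mulrA -natrM mulnC.
Qed.

Lemma holo_comp f g : holo_near0 f -> holo_near0 g -> g 0 = 0 ->
  holo_near0 (f \o g).
Proof.
move=> /near0P[d d0 df] hg g0.
have /continuousCP /(_ d d0)[d' d'0 gd] := holo_continuous0 hg.
have gball : \forall z \near (0 : C), normc (g z) < d.
  by apply/near0P; exists d' => // z zd; have := gd z; rewrite g0 !subr0; exact.
apply: filterS2 hg gball => z /derivableP dg /df /derivableP dfz.
by have [] := der_comp dfz dg.
Qed.

Lemma derive1_comp0 f g : holo_near0 f -> holo_near0 g -> g 0 = 0 ->
  derive1 (f \o g) 0 = derive1 f 0 * derive1 g 0.
Proof.
move=> /holo_derivable0 df /holo_derivable0 dg g0.
by apply: is_derive_derive1; apply: der_comp dg; rewrite g0.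
Qed.

Lemma iter_holo g n : holo_near0 g -> g 0 = 0 ->
  [/\ holo_near0 (iter n g), iter n g 0 = 0 &
      derive1 (iter n g) 0 = derive1 g 0 ^+ n].
Proof.
move=> hg g0; elim: n => [|n [hn n0 dn]].
  split; [|by []|].
    by apply/near0P; exists 1 => [|z _]; [exact: ltr01|have [] := der_id z].
  exact: (is_derive_derive1 (der_id _)).
have -> : iter n.+1 g = g \o iter n g by [].
split; [exact: holo_comp hg hn n0|by rewrite /= n0|].
by rewrite (derive1_comp0 hg hn n0) dn exprS.
Qed.

(** Let n be the order of vanishing of f(z) - z. Then n >= 2 from f(0) = 0 and f'(0) = 1, n > p from
    the vanishing derivatives, and n <= p + 1 since [inGp p.+1 f] fails. Positivity of p follows
    from n >= 2. *)
Lemma inAp_factor p f : inAp p f -> [/\ holo_near0 f, f 0 = 0, (0 < p)%N &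
  exists u, [/\ holo_near0 u, u 0 != 0 &
    germ_eq (fun z => f z - z) (fun z => z ^+ p.+1 * u z)]].
Proof.
move=> [[Gf f'0 f0p] nG]; have [hf f0 _] := Gf.
(* Opaque, so that unification never compares derivatives of [phi] and of [f]. *)
have [phi phi_def] : exists phi : C -> C, phi = fun z => f z - z by eexists.
have hphi : holo_near0 phi by rewrite phi_def; exact: holoB_id hf.
have dphi : germ_eq (derive1 phi) (fun z => derive1 f z - 1).
  rewrite phi_def; apply: filterS (holo_is_derive hf) => z dz.
  by rewrite (is_derive_derive1 (derB dz (der_id z))).
have dphi0 : derive1 phi 0 = 0 by rewrite (nbhs_singleton dphi) f'0 subrr.
(* From the second derivative on, subtracting z changes nothing. *)
have phin k : phi^`(k.+2) 0 = f^`(k.+2) 0.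
  rewrite !derive1Sn; apply: derive1n_germ.
  have h := derive1_germ dphi; have hdf := holo_is_derive (holo_derive1 hf).
  apply: filterS2 hdf h => z dz hz; apply: etrans hz _.
  by apply: etrans (is_derive_derive1 (derB dz (der_cst 1 z))) _; rewrite subr0.
have notall : ~ (forall k, (2 <= k <= p.+1)%N -> phi^`(k) 0 = 0).
  move=> H; apply: nG; split; [exact: Gf|exact: f'0|].
  move=> [|[|k]] /andP[k2 kp]; [case: (notF k2)|case: (notF k2)|].
  apply: etrans (esym (phin k)) _.
  apply: H.
  exact: kp.
clear f'0 nG Gf.
have [phi0|[n [u [hu u0 phiE]]]] := holo_factor hphi.
  exfalso; apply: notall => k _.
  apply: etrans (derive1n_germ k phi0) _.
  have d0 : derive1 (fun=> 0 : C) = (fun=> 0 : C).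
    by apply/funext => z; exact: (is_derive_derive1 (der_cst 0 z)).
  by elim: k => [|k IH]; [exact: erefl|rewrite derive1Sn d0].
have [lo hi] := derive1n_factor hu phiE.
have hi0 : phi^`(n) 0 != 0.
  by rewrite hi mulf_neq0 // pnatr_eq0 -lt0n fact_gt0.
have n2 : (2 <= n)%N.
  case: n lo hi hi0 {phiE} => [|[|n]] // _ _.
    by rewrite derive1n0 phi_def f0 subrr eqxx.
  by rewrite derive1n1 dphi0 eqxx.
have pn : (p < n)%N.
  rewrite ltnNge; apply/negP => np; move: hi0.
  case: n n2 np {lo hi phiE} => [|[|n]] // _ np.
  by rewrite phin f0p ?eqxx.
have np : (n <= p.+1)%N.
  rewrite leqNgt; apply/negP => pn1; apply: notall => k /andP[_ kp].
  by apply: lo; apply: leq_ltn_trans kp pn1.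
have nE : n = p.+1 by apply/eqP; rewrite eqn_leq np pn.
rewrite nE in phiE n2; split; [exact: hf|exact: f0|exact: n2|].
by exists u; split; [exact: hu|exact: u0|rewrite -phi_def; exact: phiE].
Qed.

End GermCalculus.

(** * Asymptotics of germs tangent to the identity *)

Section LimitCalculus.
Variable K : numFieldType.
Implicit Types (F G f g h u v w phi : K -> K) (a b l m : K).

(** The limit is punctured because quotients by positive powers of z take the default value 0 at z =
    0. *)
Definition lim0 F l := F z @[z --> (0 : K)^'] --> l.

Lemma lim0_near F G l : (\forall z \near (0 : K)^', F z = G z) -> lim0 F l -> lim0 G l.
Proof. by move=> FG; apply: cvg_trans; apply: near_eq_cvg; apply: filterS FG => z ->. Qed.

Lemma lim0D F G l m : lim0 F l -> lim0 G m -> lim0 (fun z => F z + G z) (l + m).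
Proof. exact: cvgD. Qed.

Lemma lim0N F l : lim0 F l -> lim0 (fun z => - F z) (- l).
Proof. exact: cvgN. Qed.

Lemma lim0M F G l m : lim0 F l -> lim0 G m -> lim0 (fun z => F z * G z) (l * m).
Proof. exact: cvgM. Qed.

Lemma lim0_cst l : lim0 (fun=> l) l.
Proof. exact: cvg_cst. Qed.
Arguments lim0_cst : clear implicits.

Lemma lim0X F l n : lim0 F l -> lim0 (fun z => F z ^+ n) (l ^+ n).
Proof.
move=> Fl; elim: n => [|n IH]; first by rewrite expr0; exact: lim0_cst.
rewrite exprS; have -> : (fun z => F z ^+ n.+1) = fun z => F z * F z ^+ n.
  by apply/funext => z; rewrite exprS.
exact: lim0M.
Qed.

Arguments lim0X {F l} n _.

Lemma lim0_sumX F n : lim0 F 1 -> lim0 (fun z => \sum_(i < n) F z ^+ i) n%:R.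
Proof.
move=> F1; elim: n => [|n IH].
  by apply: lim0_near (lim0_cst 0); apply: nearW => z; rewrite big_ord0.
rewrite -natr1; apply: lim0_near (lim0D IH (_ : lim0 (fun z => F z ^+ n) 1)).
  by apply: nearW => z; rewrite big_ord_recr.
by rewrite -[X in lim0 _ X](expr1n _ n); exact: lim0X.
Qed.

Arguments lim0_sumX {F} n _.

Lemma lim0_cont u : {for 0, continuous u} -> lim0 u (u 0).
Proof. by move=> cu; apply: cvg_trans cu; apply: cvg_app; exact: nbhs_dnbhs. Qed.

Lemma lim0_id : lim0 (fun z => z) 0.
Proof. exact: nbhs_dnbhs. Qed.

Lemma lim0_comp u w : {for 0, continuous u} -> lim0 w 0 -> lim0 (fun z => u (w z)) (u 0).
Proof. by move=> cu w0; exact: (cvg_comp w u w0 cu). Qed.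

Lemma lim0_unique F l m : lim0 F l -> lim0 F m -> l = m.
Proof. exact: cvg_unique. Qed.

Lemma lim0_nz : \forall z \near (0 : K)^', z != 0.
Proof. exact: nbhs_dnbhs_neq. Qed.

Lemma near_lim0 w (P : K -> Prop) : lim0 w 0 -> (\forall z \near (0 : K), P z) ->
  \forall z \near (0 : K)^', P (w z).
Proof. by move=> w0 HP; exact: w0. Qed.

(** * Increments along a map tangent to the identity *)

Lemma lim0_tangent w q b : lim0 (fun z => (w z - z) / z ^+ q.+1) b -> lim0 w 0.
Proof.
move=> wb; rewrite -[X in lim0 _ X](addr0 0) -[X in lim0 _ (_ + X)](mulr0 b).
have z0 : lim0 (fun z => z ^+ q.+1) 0.
  by rewrite -[X in lim0 _ X](expr0n _ q.+1); exact: lim0X _ lim0_id.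
apply: lim0_near (lim0D lim0_id (lim0M wb z0)).
apply: filterS lim0_nz => z nz.
by rewrite mulfVK ?expf_neq0 // addrC subrK.
Qed.

Lemma lim0_tangent_ratio w q b : (0 < q)%N ->
  lim0 (fun z => (w z - z) / z ^+ q.+1) b -> lim0 (fun z => w z / z) 1.
Proof.
move=> q0 wb; rewrite -[X in lim0 _ X](addr0 1) -[X in lim0 _ (_ + X)](mulr0 b).
have z0 : lim0 (fun z => z ^+ q) 0.
  case: q q0 {wb} => // q _; rewrite -[X in lim0 _ X](expr0n _ q.+1).
  exact: lim0X _ lim0_id.
apply: lim0_near (lim0D (lim0_cst 1) (lim0M wb z0)).
apply: filterS lim0_nz => z nz.
rewrite exprS; field.
by rewrite nz expf_neq0.
Qed.

(* [H] stands for the class of functions holomorphic near 0: all that the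
   asymptotic arguments need is that it is stable under u |-> (u - u 0) / z. *)
Variable H : (K -> K) -> Prop.
Hypothesis H_cont : forall u, H u -> {for 0, continuous u}.
Hypothesis H_slope : forall u, H u ->
  exists u1, H u1 /\ \forall z \near (0 : K), u z = u 0 + z * u1 z.

(** Writing u = u(0) + z u1 gives u(w) - u(z) = (w - z) u1(w) + z (u1(w) - u1(z)). The first term is
    O(z^(q+1)), and the second gains one power of z over the same claim for u1; hence the induction
    on m for all u at once. *)
Lemma lim0_increment0 u w q b (m : nat) : H u ->
  lim0 (fun z => (w z - z) / z ^+ q.+1) b -> (m <= q)%N ->
  lim0 (fun z => (u (w z) - u z) / z ^+ m) 0.
Proof.
move=> Hu wb; have w0 := lim0_tangent wb.
elim: m u Hu => [|m IH] u Hu mq.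
  rewrite -(subrr (u 0)).
  apply: lim0_near (lim0D (lim0_comp (H_cont Hu) w0) (lim0N (lim0_cont (H_cont Hu)))).
  by apply: nearW => z; rewrite expr0 divr1.
have [u1 [Hu1 uE]] := H_slope Hu.
have z0 : lim0 (fun z => z ^+ (q - m)) 0.
  rewrite -[X in lim0 _ X](_ : (0 : K) ^+ (q - m) = 0); first exact: lim0X _ lim0_id.
  by rewrite expr0n subn_eq0 leqNgt mq.
have := lim0D (lim0M (lim0M wb z0) (lim0_comp (H_cont Hu1) w0)) (IH _ Hu1 (ltnW mq)).
rewrite mulr0 mul0r addr0; apply: lim0_near.
have uEw := near_lim0 w0 uE; have uE' := near_lim0 lim0_id uE.
near=> z.
have nz : z != 0 by near: z; exact: lim0_nz.
have -> : u (w z) = u 0 + w z * u1 (w z) by near: z.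
have -> : u z = u 0 + z * u1 z by near: z.
have -> : z ^+ q.+1 = z ^+ (q - m) * z ^+ m.+1 by rewrite -exprD addnS subnK // ltnW.
rewrite exprS; field.
by rewrite !expf_neq0 // nz.
Unshelve. all: by end_near. Qed.

(** The rigorous form of phi(w) - phi(z) ~ phi'(z)(w - z): in (w^n - z^n) u(w) + z^n (u(w) - u(z))
    the second term is negligible by [lim0_increment0]. *)
Lemma lim0_increment phi u w n q b : H u -> (0 < q)%N ->
  (\forall z \near (0 : K), phi z = z ^+ n * u z) ->
  lim0 (fun z => (w z - z) / z ^+ q.+1) b ->
  lim0 (fun z => (phi (w z) - phi z) / z ^+ (n + q)) (n%:R * u 0 * b).
Proof.
move=> Hu q0 phiE wb.
have w0 := lim0_tangent wb; have w1 := lim0_tangent_ratio q0 wb.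
have := lim0D (lim0M (lim0M wb (lim0_sumX n w1)) (lim0_comp (H_cont Hu) w0))
  (lim0_increment0 Hu wb (leqnn q)).
have -> : b * n%:R * u 0 + 0 = n%:R * u 0 * b by ring.
apply: lim0_near.
have phiEw := near_lim0 w0 phiE; have phiE' := near_lim0 lim0_id phiE.
near=> z.
have nz : z != 0 by near: z; exact: lim0_nz.
have -> : phi (w z) = w z ^+ n * u (w z) by near: z.
have -> : phi z = z ^+ n * u z by near: z.
(* The geometric sum in w/z carries the factor n: it has n terms, each tending to 1. *)
have wzE : w z ^+ n = z ^+ n * (z ^+ q * ((w z - z) / z ^+ q.+1) *
    (\sum_(i < n) (w z / z) ^+ i) + 1).
  have -> : z ^+ q * ((w z - z) / z ^+ q.+1) = w z / z - 1.
    by rewrite exprS; field; rewrite nz expf_neq0.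
  by rewrite -subrX1 subrK -exprMn mulrC divfK.
rewrite wzE exprD.
move: (\sum_(i < n) _) => S; rewrite exprS; field.
by rewrite nz !expf_neq0.
Unshelve. all: by end_near. Qed.

Lemma lim0_ratio phi u q : H u ->
  (\forall z \near (0 : K), phi z - z = z ^+ q.+1 * u z) ->
  lim0 (fun z => (phi z - z) / z ^+ q.+1) (u 0).
Proof.
move=> Hu phiE; apply: lim0_near (lim0_cont (H_cont Hu)).
near=> z.
have nz : z != 0 by near: z; exact: lim0_nz.
have -> : phi z - z = z ^+ q.+1 * u z by near: z; exact: near_lim0 lim0_id phiE.
by rewrite [_ * u z]mulrC mulfK // expf_neq0.
Unshelve. all: by end_near. Qed.

(** Let a = u(0) and c = v(0). The increment g(f z) - g(z) is equivalent to c a z^(p+1). With y =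
    g(f z) it is also -(f(y) - y), equivalent to -a c^(p+1) z^(p+1). Hence c^p = -1. *)
Lemma reversor_multiplier f g u v p : H u -> H v -> (0 < p)%N ->
  (\forall z \near (0 : K), f z - z = z ^+ p.+1 * u z) -> u 0 != 0 ->
  (\forall z \near (0 : K), g z = z * v z) -> v 0 != 0 ->
  (\forall z \near (0 : K), f (g (f z)) = g z) -> v 0 ^+ p = -1.
Proof.
move=> Hu Hv p0 fE u0 gE v0 fgf.
have fa := lim0_ratio Hu fE; have f0 := lim0_tangent fa.
have inc := lim0_increment (phi := g) (n := 1) Hv p0 gE fa.
have gf1 : lim0 (fun z => g (f z) / z) (1 * v 0).
  apply: lim0_near (lim0M (lim0_tangent_ratio p0 fa) (lim0_comp (H_cont Hv) f0)).
  apply: filterS (near_lim0 f0 gE) => z ->.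
  by rewrite mulrAC.
have gf0 : lim0 (fun z => g (f z)) 0.
  rewrite -(mulr0 (1 * v 0)); apply: lim0_near (lim0M gf1 lim0_id).
  by apply: filterS lim0_nz => z nz; rewrite divfK.
have inc' : lim0 (fun z => (g (f z) - g z) / z ^+ (1 + p))
    (- ((1 * v 0) ^+ p.+1 * u 0)).
  apply: lim0_near (lim0N (lim0M (lim0X p.+1 gf1) (lim0_comp (H_cont Hu) gf0))).
  near=> z.
  have <- : f (g (f z)) = g z by near: z; exact: near_lim0 lim0_id fgf.
  have fgE : f (g (f z)) - g (f z) = g (f z) ^+ p.+1 * u (g (f z)).
    by near: z; exact: near_lim0 gf0 fE.
  by rewrite -opprB fgE add1n expr_div_n mulNr mulrAC.
have := lim0_unique inc inc'; rewrite !mul1r exprS -mulrA -mulrN.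
move=> /(mulfI v0) => E; apply: (mulIf u0).
by rewrite mulN1r [in RHS]E opprK.
Unshelve. all: by end_near. Qed.

(** By commutation f(h) - h - (f - z) = h(f) - f - (h - z). Divided by z^(p+q+1), the two sides tend
    to (p+1) a b and (q+1) a b, where a = u(0) and b = v(0). *)
Lemma commuting_order f h u v p q : H u -> H v -> (0 < p)%N -> (0 < q)%N ->
  (\forall z \near (0 : K), f z - z = z ^+ p.+1 * u z) -> u 0 != 0 ->
  (\forall z \near (0 : K), h z - z = z ^+ q.+1 * v z) -> v 0 != 0 ->
  (\forall z \near (0 : K), f (h z) = h (f z)) -> p = q.
Proof.
move=> Hu Hv p0 q0 fE u0 hE v0 fh.
have inc := lim0_increment (phi := fun z => f z - z) Hu q0 fE (lim0_ratio Hv hE).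
have inc' := lim0_increment (phi := fun z => h z - z) Hv p0 hE (lim0_ratio Hu fE).
have {}inc : lim0 (fun z => (h (f z) - f z - (h z - z)) / z ^+ (q.+1 + p))
    (p.+1%:R * u 0 * v 0).
  apply: lim0_near inc; near=> z.
  have -> : f (h z) = h (f z) by near: z; exact: near_lim0 lim0_id fh.
  by rewrite (_ : (p.+1 + q = q.+1 + p)%N) ?addSn ?[(p + q)%N]addnC //; congr (_ / _); ring.
have := lim0_unique inc inc'; rewrite -!mulrA [v 0 * u 0]mulrC.
move=> /(mulIf (mulf_neq0 u0 v0)) /eqP; rewrite eqr_nat => /eqP.
by case.
Unshelve. all: by end_near. Qed.

(** With c = u(0) and b = v(0), the increment g(h) - g(z) has leading coefficient c b, while h(g) -
    g has c^(q+1) b. *)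
Lemma commuting_multiplier g h u v q : H u -> H v -> (0 < q)%N ->
  (\forall z \near (0 : K), g z = z * u z) -> u 0 != 0 ->
  (\forall z \near (0 : K), h z - z = z ^+ q.+1 * v z) -> v 0 != 0 ->
  (\forall z \near (0 : K), g (h z) = h (g z)) -> u 0 ^+ q = 1.
Proof.
move=> Hu Hv q0 gE u0 hE v0 gh.
have inc := lim0_increment (phi := g) (n := 1) Hu q0 gE (lim0_ratio Hv hE).
have g1 : lim0 (fun z => g z / z) (u 0).
  apply: lim0_near (lim0_cont (H_cont Hu)); near=> z.
  have nz : z != 0 by near: z; exact: lim0_nz.
  have -> : g z = z * u z by near: z; exact: near_lim0 lim0_id gE.
  by rewrite [z * _]mulrC mulfK.
have g0 : lim0 g 0.
  rewrite -(mulr0 (u 0)); apply: lim0_near (lim0M g1 lim0_id).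
  by apply: filterS lim0_nz => z nz; rewrite divfK.
have inc' : lim0 (fun z => (g (h z) - g z) / z ^+ (1 + q)) (u 0 ^+ q.+1 * v 0).
  apply: lim0_near (lim0M (lim0X q.+1 g1) (lim0_comp (H_cont Hv) g0)).
  near=> z.
  have -> : g (h z) = h (g z) by near: z; exact: near_lim0 lim0_id gh.
  have -> : h (g z) - g z = g z ^+ q.+1 * v (g z) by near: z; exact: near_lim0 g0 hE.
  by rewrite add1n expr_div_n mulrAC.
have := lim0_unique inc inc'; rewrite mul1r exprS -!mulrA => /(mulfI u0) E.
by apply: (mulIf v0); rewrite mul1r.
Unshelve. all: by end_near. Qed.

End LimitCalculus.

(** * Reversors *)

Section Reversors.
Variable R : realType.
Local Notation C := (CC R).
Implicit Types (f g h : C -> C) (z w : C).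

Lemma near_comp0 (P : C -> Prop) h : holo_near0 h -> h 0 = 0 ->
  (\forall z \near (0 : C), P z) -> \forall z \near (0 : C), P (h z).
Proof.
move=> /holo_continuous0 /continuousCP ch h0 /near0P[d d0 HP].
have [d' d'0 Hd] := ch _ d0; apply/near0P; exists d' => [|z zd]; first exact: d'0.
by apply: HP; have := Hd z; rewrite h0 !subr0; exact.
Qed.

Lemma holo_slope0 g : holo_near0 g -> g 0 = 0 ->
  exists v, [/\ holo_near0 v, v 0 = derive1 g 0 &
    \forall z \near (0 : C), g z = z * v z].
Proof.
move=> hg g0; have [v [hv]] := holo_slope hg; rewrite g0 => gE.
have {}gE : \forall z \near (0 : C), g z = z * v z.
  by apply: filterS gE => z ->; rewrite add0r.
exists v; split; [exact: hv| |exact: gE].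
have gE1 : germ_eq g (fun z => z ^+ 1 * v z).
  by apply: filterS gE => z ->; rewrite expr1.
by have [_] := derive1n_factor hv gE1; rewrite derive1n1 mul1r.
Qed.

(** At f(z) the relation reads gi(f(g(f z))) = z; applying g removes both inverses. Continuity keeps
    all intermediate points where the germ identities hold. *)
Lemma reversor_identity f g : holo_near0 f -> f 0 = 0 -> inRf f g ->
  \forall z \near (0 : C), f (g (f z)) = g z.
Proof.
move=> hf f0 [[hg g0 _] [gi [fi [[_ ggi _] [_ _ fif] E]]]].
have hgf := holo_comp hg hf f0.
have gf0 : (g \o f) 0 = 0 by rewrite /= f0.
have hw := holo_comp hf hgf gf0.
have w0 : (f \o (g \o f)) 0 = 0 by rewrite /= f0 g0.
have E1 := near_comp0 hf f0 E; have E2 := near_comp0 hw w0 ggi.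
apply: filterS3 fif E1 E2 => z /= fz e1 e2.
by rewrite -[LHS]e2 e1 fz.
Qed.

(** Two reversals commute: f(g(g z)) = f(g(f(g(f z)))) = g(g(f z)). *)
Lemma iter_double_commute f g s : holo_near0 f -> f 0 = 0 ->
  holo_near0 g -> g 0 = 0 ->
  (\forall z \near (0 : C), f (g (f z)) = g z) ->
  \forall z \near (0 : C), f (iter (2 * s) g z) = iter (2 * s) g (f z).
Proof.
move=> hf f0 hg g0 fgf.
have gg : \forall z \near (0 : C), f (g (g z)) = g (g (f z)).
  have gf0 : (g \o f) 0 = 0 by rewrite /= f0.
  have e := near_comp0 (holo_comp hg hf f0) gf0 fgf.
  by apply: filterS2 fgf e => z e1 /= <-; rewrite e1.
elim: s => [|s IH]; first by apply/near0P; exists 1.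
have [hi i0 _] := iter_holo (2 * s) hg g0.
apply: filterS2 IH (near_comp0 hi i0 gg) => z e1 e2.
have iE y : iter (2 * s.+1) g y = g (g (iter (2 * s) g y)) by rewrite mulnS.
by rewrite !iE e2 e1.
Qed.

(** The order m of a divides 2p but not p. An odd m would divide p, so m = 2s with s dividing p, and
    an even p/s would again make m divide p. *)
Lemma root_of_minus_one_order (K : numFieldType) (a : K) p : (0 < p)%N -> a ^+ p = -1 ->
  exists s, [/\ (0 < s)%N, (2 * s).-primitive_root a & (s %| p)%N && odd (p %/ s)].
Proof.
move=> p0 ap.
have N1 : (-1 : K) != 1.
  by rewrite -subr_eq0 -opprD oppr_eq0 -mulr2n pnatr_eq0.
have a2p : a ^+ (2 * p) = 1 by rewrite mulnC exprM ap sqrrN expr1n.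
have p20 : (0 < 2 * p)%N by rewrite muln_gt0.
have [m am mp] := prim_order_exists p20 a2p.
have mNp : ~~ (m %| p)%N by rewrite (prim_order_dvd am) // ap.
have em : ~~ odd m.
  apply: contra mNp => om; rewrite -(@Gauss_dvdr m 2) //.
  by rewrite coprime_sym coprime2n.
have mE : m = (2 * m./2)%N by rewrite mul2n even_halfK.
have m0 := prim_order_gt0 am.
exists m./2; have s0 : (0 < m./2)%N by rewrite half_gt0; move: m0 em; case: (m) => [|[]].
rewrite -mE; split => //.
have sp : (m./2 %| p)%N by rewrite -(@dvdn_pmul2l 2) // -mE.
rewrite sp /=; apply: contraT => ev; case/negP: mNp.
by rewrite mE -(divnK sp) dvdn_pmul2r // dvdn2.
Qed.

Lemma reversor_power_id f g p s : inAp p f -> inG g ->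
  (\forall z \near (0 : C), f (g (f z)) = g z) ->
  derive1 g 0 ^+ p = -1 -> derive1 g 0 ^+ (2 * s) = 1 ->
  germ_eq (iter (2 * s) g) (fun z => z).
Proof.
move=> /inAp_factor[hf f0 p0 [u [hu u0 fE]]] [hg g0 dg0] fgf lp ls.
have [hh h0 dh] := iter_holo (2 * s) hg g0.
rewrite ls in dh.
have fh := iter_double_commute s hf f0 hg g0 fgf.
have gh : \forall z \near (0 : C), g (iter (2 * s) g z) = iter (2 * s) g (g z).
  by apply/near0P; exists 1 => // z _; rewrite -iterSr.
move: (iter (2 * s) g) hh h0 dh fh gh => h hh h0 dh fh gh.
have [hid|[n [w [hw w0 hE]]]] := holo_factor (holoB_id hh).
  by apply: filterS hid => z /eqP; rewrite subr_eq0 => /eqP.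
exfalso.
have [v [hv v0 gE]] := holo_slope0 hg g0.
rewrite -v0 in lp dg0.
have {dh} dh : derive1 (fun z => h z - z) 0 = 0.
  apply: etrans (is_derive_derive1 (derB (holo_derivable0 hh) (der_id 0))) _.
  by rewrite dh subrr.
(* Order 0 is excluded by h(0) = 0 and order 1 by h'(0) = 1. *)
have n2 : (1 < n)%N.
  case: n hE => [|[|n]] hE; last by [].
  - have := nbhs_singleton hE; rewrite h0 subrr expr0 mul1r => e.
    by rewrite -e eqxx in w0.
  - have [_] := derive1n_factor hw hE; rewrite derive1n1 dh mul1r => e.
    by rewrite -e eqxx in w0.
case: n n2 hE => // q q0 hE.
have pq := commuting_order (@holo_continuous0 R) (@holo_slope R)
  hu hw p0 q0 fE u0 hE w0 fh.
have lq := commuting_multiplier (@holo_continuous0 R) (@holo_slope R)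
  hv hw q0 gE dg0 hE w0 gh.
move: lp; rewrite pq lq => /eqP.
by rewrite -subr_eq0 opprK -mulr2n pnatr_eq0.
Qed.

End Reversors.

Theorem theorem1p4 (R : realType) (p : nat) (f g : CC R -> CC R) :
  inAp p f -> inRf f g ->
  exists s : nat,
    [/\ (0 < s)%N, germ_order g (2 * s) & (s %| p)%N && odd (p %/ s)].
Proof.
move=> fA gR; have [hf f0 p0 [u [hu u0 fE]]] := inAp_factor fA.
have [gG _] := gR; have [hg g0 dg0] := gG.
have fgf := reversor_identity hf f0 gR.
have [v [hv v0 gE]] := holo_slope0 hg g0.
have v0n : v 0 != 0 by rewrite v0.
have lp := reversor_multiplier (@holo_continuous0 R) (@holo_slope R)
  hu hv p0 fE u0 gE v0n fgf.
rewrite v0 in lp.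
have [s [s0 prim sp]] := root_of_minus_one_order p0 lp.
exists s; split => //; split.
- by rewrite muln_gt0.
- exact: reversor_power_id fA gG fgf lp (prim_expr_order prim).
(* An iterate equal to the identity germ has multiplier c^k = 1, so the order 2s of c divides k. *)
move=> k /andP[k0 ks] gk.
have [_ _ dk] := iter_holo k hg g0.
have := nbhs_singleton (derive1_germ gk).
rewrite dk (is_derive_derive1 (der_id 0)) => /eqP.
rewrite -(prim_order_dvd prim) => /dvdn_leq; rewrite k0 leqNgt ks.
by move=> /(_ isT).
Qed.
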